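(* Let $G=(V,E)$ be a connected graph with maximum vertex degree at most $4$, and let $\mathcal{T}_1,\ldots,\mathcal{T}_r\subseteq V$ be subsets of vertices (terminals), not necessarily disjoint. Suppose $G$ is $\alpha$-well-linked for $\bigcup_{j=1}^r\mathcal{T}_j$ for some $\alpha<1$, that $|\mathcal{T}_1|=k_1$ and $|\mathcal{T}_j|=k_2$ for all $1<j\le r$, where $k_1,k_2\ge c\, r^2\log r/\alpha$ for a suitable universal constant $c$. Then there is an efficient randomized algorithm that with high probability computes, for each $1\le j\le r$, a subset $\mathcal{T}'_j\subseteq\mathcal{T}_j$ such that the sets $\mathcal{T}'_1,\ldots,\mathcal{T}'_r$ are pairwise disjoint, $|\mathcal{T}'_j|=\Omega(\alpha/r^2)\cdot|\mathcal{T}_j|$ for all $1\le j\le r$, and $G$ is $1$-well-linked for $\bigcup_{j=1}^r\mathcal{T}'_j$.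
   Context: For a graph $G$ and a vertex set $\mathcal{T}$, $G$ is $\alpha$-well-linked for $\mathcal{T}$ iff for every partition $(A,B)$ of $V(G)$, $|E(A,B)|\ge\alpha\cdot\min\{|A\cap\mathcal{T}|,|B\cap\mathcal{T}|\}$. ''With high probability'' means with probability $1-1/\mathrm{poly}(n)$. *)

(* Defs.v *)
(* MathComp / MathComp-Analysis. *)
From HB Require Import structures.
From mathcomp Require Import all_boot all_order all_algebra.
From mathcomp Require Import reals exp.

Set Implicit Arguments.
Unset Strict Implicit.
Unset Printing Implicit Defensive.

Import Order.TTheory GRing.Theory Num.Theory.

Local Open Scope ring_scope.

(** * Graphs and well-linkedness *)

(* A finite simple graph is a symmetric irreflexive relation on a finType. *)
Section Graphs.
Variables (V : finType) (e : rel V).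

Definition simple_graph : Prop := symmetric e /\ irreflexive e.

Definition connected_graph : Prop :=
  (0 < #|V|)%N /\ forall u v : V, connect e u v.

Definition degree (v : V) : nat := #|[set u | e v u]|.

(* For disjoint A and B every edge between them is counted exactly once, as
   the ordered pair whose first component lies in A. *)
Definition edges_between (A B : {set V}) : {set V * V} :=
  [set p | [&& p.1 \in A, p.2 \in B & e p.1 p.2]].

(* The partitions (A, B) of V are the pairs (A, ~: A). *)
Definition well_linked (R : realType) (alpha : R) (T : {set V}) : bool :=
  [forall A : {set V},
     alpha * (minn #|A :&: T| #|~: A :&: T|)%:R
       <= #|edges_between A (~: A)|%:R].

End Graphs.

(** * Randomized algorithms *)

(* A unit-cost random-access machine with addition and truncated subtraction
   (but no multiplication, so that the bit length of a number grows by O(1)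
   per step and a polynomial number of steps is polynomial time in the usual
   sense), programmed with structured control flow, and with an instruction
   that draws a fair random bit.  Memory cells hold natural numbers and are
   addressed by pairs of natural numbers. *)
Definition memory := nat -> nat -> nat.

Inductive expr : Type :=
  | Const of nat
  | Read of expr & expr
  | Add of expr & expr
  | Sub of expr & expr.

Inductive cmd : Type :=
  | Skip
  | Store of expr & expr & expr      (* mem[e1, e2] := e3 *)
  | Flip of expr & expr              (* mem[e1, e2] := random bit *)
  | Seq of cmd & cmd
  | If of expr & cmd & cmd           (* a nonzero value counts as true *)
  | While of expr & cmd.

Fixpoint eval (M : memory) (a : expr) : nat :=
  match a with
  | Const k => k
  | Read a1 a2 => M (eval M a1) (eval M a2)
  | Add a1 a2 => (eval M a1 + eval M a2)%N
  | Sub a1 a2 => (eval M a1 - eval M a2)%N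
  end.

Definition update (M : memory) (i j x : nat) : memory :=
  fun i' j' => if (i' == i) && (j' == j) then x else M i' j'.

(* The stack of commands still to be executed, the memory, and the random
   bits not read yet.  The machine has halted when the stack is empty. *)
Record config := Config { code : seq cmd; contents : memory; coins : seq bool }.

(* One instruction; an expression has a size fixed by the program, so its
   evaluation is charged to the instruction containing it.  On an exhausted
   coin sequence [Flip] writes 0; this is irrelevant below, where the number
   of coins supplied is at least the number of steps performed. *)
Definition step (s : config) : config :=
  let: Config k M w := s in
  match k with
  | [::] => s
  | Skip :: k' => Config k' M w
  | Store a1 a2 a3 :: k' =>
      Config k' (update M (eval M a1) (eval M a2) (eval M a3)) w
  | Flip a1 a2 :: k' =>
      Config k' (update M (eval M a1) (eval M a2) (nat_of_bool (head false w)))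
        (behead w)
  | Seq c1 c2 :: k' => Config (c1 :: c2 :: k') M w
  | If a c1 c2 :: k' => Config ((if eval M a == 0%N then c2 else c1) :: k') M w
  | While a c :: k' =>
      if eval M a == 0%N then Config k' M w
      else Config (c :: While a c :: k') M w
  end.

Definition run (P : cmd) (M : memory) (w : seq bool) (t : nat) : config :=
  iter t step (Config [:: P] M w).

Definition halts_within (P : cmd) (M : memory) (w : seq bool) (t : nat) : bool :=
  nilp (code (run P M w t)).

(* The probability of an event depending on m independent fair coins. *)
Definition coin_prob (R : realType) (m : nat) (E : pred (m.-tuple bool)) : R :=
  #|[set w : m.-tuple bool | E w]|%:R / 2 ^+ m.

(** * Encoding of the input and of the output *)

(* Row 0 holds n, r and the numerator and denominator of a rational number;
   row u + 1 (for u < n) is the u-th row of the adjacency matrix; row n + j + 1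
   (for j < r) is the indicator vector of T j; all other cells hold 0. *)
Definition input (n r : nat) (e : rel 'I_n) (T : 'I_r -> {set 'I_n})
    (num den : nat) : memory :=
  fun i j =>
    if i == 0%N then nth 0%N [:: n; r; num; den] j
    else nat_of_bool
      ([exists u : 'I_n, exists v : 'I_n,
          [&& i == u.+1, j == v :> nat & e u v]]
       || [exists l : 'I_r, exists v : 'I_n,
          [&& i == (n + l).+1, j == v :> nat & v \in T l]]).

(* Polynomially equivalent to the bit length of the input. *)
Definition input_size (n r num den : nat) : nat :=
  (n + r + trunc_log 2 num + trunc_log 2 den)%N.

(* The output overwrites the indicator vectors of the input. *)
Definition output (n r : nat) (M : memory) : 'I_r -> {set 'I_n} :=
  fun l => [set v : 'I_n | M (n + l).+1 v != 0%N].
Arguments output : clear implicits.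

(** * The required output *)

(* c is the constant hidden in the Omega. *)
Definition good_subsets (R : realType) (n r : nat) (e : rel 'I_n)
    (T : 'I_r -> {set 'I_n}) (alpha c : R) (T' : 'I_r -> {set 'I_n}) : bool :=
  [&& [forall j, T' j \subset T j],
      [forall i, forall j, (i != j) ==> [disjoint T' i & T' j]],
      [forall j, c * (alpha / r%:R ^+ 2) * #|T j|%:R <= #|T' j|%:R]
    & well_linked e (1 : R) (\bigcup_j T' j)].

(* Main.v *)
Require Import Defs.
From HB Require Import structures.
From mathcomp Require Import all_boot all_order all_algebra.
From mathcomp Require Import reals exp.
From mathcomp Require Import zify ring lra.

(* No randomness is used: a deterministic greedy algorithm succeeds.

   Let w(A) be the number of terminals in A, let q be an integer of order
   1/alpha, and let cut2(A) be the size of the cut of A with every bridge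
   counted twice.  Call a set I of terminals routable if
     2 q |I n A| <= q cut2(A) + w(A)   for all A,
   which says that every element of I can send 2q units of flow to the
   terminals, with capacity q (2q on bridges) on edges and 1 at each terminal,
   and is decided by a maximum flow computation.

   Routable sets are 1-well-linked.  If A has the minority of the terminals,
   then w(A) is at most q cut(A) / 2.  If no bridge leaves A, then
   cut2(A) = cut(A), so |I n A| <= cut(A).  If a bridge leaves A, its small side
   D contains at most one element of I, and replacing A by A \ D or by A u D
   lowers cut(A) while losing at most one element of I.

   Routable sets can be extended: if |S| >= (32 |I| + 4) q, then I u {t} is
   routable for some t in S.  Otherwise every t in S \ I lies in a set A_t that
   rejects t.  Among the sets K containing I and a minority of the terminals,
   choose one with cut2(K) minimal, and among these a maximal one; by the degree
   bound cut2(K) <= 8 |I|.  By submodularity cut2(K u A_t) <= cut2(K) + 1, and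
   adding A_t to a superset U of K either does not increase cut2(U), or increases
   it by one while A_t \ K absorbs an edge leaving K (as every proper cut has
   cut2 >= 2).  Hence a maximal such U has cut2(U) <= 2 cut2(K); it contains S and
   at most 8 q |I| terminals, a contradiction.

   In each of n rounds the algorithm adds at most one terminal of each T_j; after
   s rounds at most r s terminals are chosen, so T_j contributes in each of the
   first s rounds as soon as (32 r s + 4) q <= |T_j|. *)

Set Implicit Arguments.
Unset Strict Implicit.
Unset Printing Implicit Defensive.

Import Order.TTheory GRing.Theory Num.Theory.

Local Open Scope nat_scope.

(** * A loop language and its compilation *)

Inductive aexp : Type :=
  | ANum of nat
  | AVar of nat
  | AArr of nat & aexp & aexp
  | AIn of aexp & aexp
  | AAdd of aexp & aexp
  | ASub of aexp & aexp.

Inductive bnd : Type := BNum of nat | BVerts | BSets.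

Inductive prog : Type :=
  | PSkip
  | PSet of nat & aexp
  | PArr of nat & aexp & aexp & aexp
  | POut of aexp & aexp & aexp
  | PSeq of prog & prog
  | PIf of aexp & prog & prog
  | PFor of nat & bnd & prog.

Record state := State {
  vr : nat -> nat;
  ar : nat -> nat -> nat -> nat;
  ip : nat -> nat -> nat }.

Definition set_vr (s : state) k x : state :=
  State (fun k' => if k' == k then x else vr s k') (ar s) (ip s).
Definition set_ar (s : state) k a b x : state :=
  State (vr s)
    (fun k' => if k' == k then update (ar s k) a b x else ar s k') (ip s).
Definition set_ip (s : state) a b x : state :=
  State (vr s) (ar s) (update (ip s) a b x).

(* Row i + 1 of the machine's memory: the rows of the input come first, and the
   eight arrays of the program are interleaved behind them, so that they never
   overlap, whatever their indices are.  The variables live in row 0. *)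
Definition mrow (s : state) i j : nat :=
  let m := vr s 0 + vr s 1 in
  if i < m then ip s i j else ar s ((i - m) %% 8) ((i - m) %/ 8) j.

Fixpoint ev (s : state) (a : aexp) : nat :=
  match a with
  | ANum x => x
  | AVar k => vr s k
  | AArr k a1 a2 => ar s k (ev s a1) (ev s a2)
  | AIn a1 a2 => mrow s (ev s a1) (ev s a2)
  | AAdd a1 a2 => ev s a1 + ev s a2
  | ASub a1 a2 => ev s a1 - ev s a2
  end.

Definition bval (s : state) (b : bnd) : nat :=
  match b with BNum x => x | BVerts => vr s 0 | BSets => vr s 1 end.

Fixpoint den (p : prog) (s : state) : state :=
  match p with
  | PSkip => s
  | PSet k a => set_vr s k (ev s a)
  | PArr k a1 a2 a3 => set_ar s k (ev s a1) (ev s a2) (ev s a3)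
  | POut a1 a2 a3 =>
      if ev s a1 < vr s 0 + vr s 1 then set_ip s (ev s a1) (ev s a2) (ev s a3)
      else s
  | PSeq p1 p2 => den p2 (den p1 s)
  | PIf a p1 p2 => if ev s a == 0 then den p2 s else den p1 s
  | PFor k b p1 =>
      iter (bval s b) (fun s' => set_vr (den p1 s') k (vr s' k).+1) (set_vr s k 0)
  end.

Definition rd k := Read (Const 0) (Const k).
Definition arow k (e : expr) : expr :=
  let e2 := Add e e in let e4 := Add e2 e2 in
  Add (Add (rd 0) (rd 1)) (Add (Add e4 e4) (Const k.+1)).

Fixpoint aofs (a : aexp) : bool :=
  match a with
  | ANum _ | AVar _ => true
  | AArr k a1 a2 => [&& k < 8, aofs a1 & aofs a2]
  | AIn a1 a2 | AAdd a1 a2 | ASub a1 a2 => aofs a1 && aofs a2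
  end.

Fixpoint cexp (a : aexp) : expr :=
  match a with
  | ANum x => Const x
  | AVar k => rd k
  | AArr k a1 a2 => Read (arow k (cexp a1)) (cexp a2)
  | AIn a1 a2 => Read (Add (cexp a1) (Const 1)) (cexp a2)
  | AAdd a1 a2 => Add (cexp a1) (cexp a2)
  | ASub a1 a2 => Defs.Sub (cexp a1) (cexp a2)
  end.

Definition cbnd (b : bnd) : expr :=
  match b with BNum x => Const x | BVerts => rd 0 | BSets => rd 1 end.

Fixpoint compile (p : prog) : cmd :=
  match p with
  | PSkip => Skip
  | PSet k a => Store (Const 0) (Const k) (cexp a)
  | PArr k a1 a2 a3 => Store (arow k (cexp a1)) (cexp a2) (cexp a3)
  | POut a1 a2 a3 =>
      If (Defs.Sub (Add (rd 0) (rd 1)) (cexp a1))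
        (Store (Add (cexp a1) (Const 1)) (cexp a2) (cexp a3)) Skip
  | PSeq p1 p2 => Seq (compile p1) (compile p2)
  | PIf a p1 p2 => If (cexp a) (compile p1) (compile p2)
  | PFor k b p1 =>
      Seq (Store (Const 0) (Const k) (Const 0))
        (While (Defs.Sub (cbnd b) (rd k))
          (Seq (compile p1) (Store (Const 0) (Const k) (Add (rd k) (Const 1)))))
  end.

Fixpoint wvars (p : prog) : seq nat :=
  match p with
  | PSet k _ => [:: k]
  | PSeq p1 p2 | PIf _ p1 p2 => wvars p1 ++ wvars p2
  | PFor k _ p1 => k :: wvars p1
  | _ => [::]
  end.
Fixpoint warrs (p : prog) : seq nat :=
  match p with
  | PArr k _ _ _ => [:: k]
  | PSeq p1 p2 | PIf _ p1 p2 => warrs p1 ++ warrs p2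
  | PFor _ _ p1 => warrs p1
  | _ => [::]
  end.
Fixpoint outs (p : prog) : bool :=
  match p with
  | POut _ _ _ => true
  | PSeq p1 p2 | PIf _ p1 p2 => outs p1 || outs p2
  | PFor _ _ p1 => outs p1
  | _ => false
  end.

Fixpoint wf (p : prog) : bool :=
  match p with
  | PSkip => true
  | PSet k a => (3 < k) && aofs a
  | PArr k a1 a2 a3 => [&& k < 8, aofs a1, aofs a2 & aofs a3]
  | POut a1 a2 a3 => [&& aofs a1, aofs a2 & aofs a3]
  | PSeq p1 p2 => wf p1 && wf p2
  | PIf a p1 p2 => [&& aofs a, wf p1 & wf p2]
  | PFor k _ p1 => [&& 3 < k, k \notin wvars p1 & wf p1]
  end.

Lemma den_vr p s k : k \notin wvars p -> vr (den p s) k = vr s k.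
Proof.
elim: p s => //=.
- by move=> k' a s; rewrite inE => /negbTE ->.
- by move=> a1 a2 a3 s _; case: ifP.
- by move=> p1 IH1 p2 IH2 s; rewrite mem_cat negb_or => /andP[? ?]; rewrite IH2 ?IH1.
- move=> a p1 IH1 p2 IH2 s; rewrite mem_cat negb_or => /andP[? ?].
  by case: ifP => _; rewrite ?IH2 ?IH1.
- move=> k' b p1 IH s; rewrite inE negb_or => /andP[/negbTE nk kp].
  by elim: (bval s b) => [|m IHm] /=; rewrite nk // IH.
Qed.

Lemma den_ar p s k : k \notin warrs p -> ar (den p s) k = ar s k.
Proof.
elim: p s => //=.
- by move=> k' a1 a2 a3 s; rewrite inE => /negbTE ->.
- by move=> a1 a2 a3 s _; case: ifP.
- by move=> p1 IH1 p2 IH2 s; rewrite mem_cat negb_or => /andP[? ?]; rewrite IH2 ?IH1.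
- move=> a p1 IH1 p2 IH2 s; rewrite mem_cat negb_or => /andP[? ?].
  by case: ifP => _; rewrite ?IH2 ?IH1.
- move=> k' b p1 IH s kp.
  by elim: (bval s b) => [|m IHm] //=; rewrite IH.
Qed.

Lemma den_vr_sub p (W : seq nat) : all (mem W) (wvars p) ->
  forall s k, k \notin W -> vr (den p s) k = vr s k.
Proof. by move=> /allP pW s k kW; apply: den_vr; apply: contra kW => /pW. Qed.

Lemma den_ar_sub p (W : seq nat) : all (mem W) (warrs p) ->
  forall s k, k \notin W -> ar (den p s) k = ar s k.
Proof. by move=> /allP pW s k kW; apply: den_ar; apply: contra kW => /pW. Qed.

Lemma den_ip p s : ~~ outs p -> ip (den p s) = ip s.
Proof.
elim: p s => //=.
- by move=> p1 IH1 p2 IH2 s; rewrite negb_or => /andP[? ?]; rewrite IH2 ?IH1.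
- move=> a p1 IH1 p2 IH2 s; rewrite negb_or => /andP[? ?].
  by case: ifP => _; rewrite ?IH2 ?IH1.
- move=> k' b p1 IH s kp.
  by elim: (bval s b) => [|m IHm] //=; rewrite IH.
Qed.

Lemma wf_wvars p k : wf p -> k < 4 -> k \notin wvars p.
Proof.
move=> + k4; elim: p => //=.
- by move=> k' a /andP[? _]; rewrite inE; lia.
- by move=> p1 IH1 p2 IH2 /andP[/IH1 ? /IH2 ?]; rewrite mem_cat negb_or; apply/andP.
- by move=> a p1 IH1 p2 IH2 /and3P[_ /IH1 ? /IH2 ?]; rewrite mem_cat negb_or; apply/andP.
- by move=> k' b p1 IH /and3P[? _ /IH ?]; rewrite inE negb_or; apply/andP; split=> //; lia.
Qed.

Local Opaque arow.

Definition sim (M : memory) (s : state) : Prop :=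
  (forall k, M 0 k = vr s k) /\ (forall i j, M i.+1 j = mrow s i j).

Lemma row_arr s k a j : k < 8 ->
  mrow s (vr s 0 + vr s 1 + (8 * a + k)) j = ar s k a j.
Proof.
move=> k8; rewrite /mrow ltnNge leq_addr /= addKn mulnC modnMDl divnMDl //.
by rewrite modn_small // divn_small // addn0.
Qed.

Lemma eval_arow M s k e : sim M s ->
  eval M (arow k e) = (vr s 0 + vr s 1 + (8 * eval M e + k)).+1.
Proof. by case=> Mv _; rewrite -[arow _ _]/(Add (Add (rd 0) (rd 1)) (Add (Add (Add (Add e e) (Add e e)) (Add (Add e e) (Add e e))) (Const k.+1))) /= !Mv; lia. Qed.

Lemma eval_cexp M s a : sim M s -> aofs a -> eval M (cexp a) = ev s a.
Proof.
move=> Ms; have [Mv Mr] := Ms; elim: a => //=.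
- move=> k a1 IH1 a2 IH2 /and3P[k8 /IH1 E1 /IH2 E2]; by rewrite (eval_arow _ _ Ms) Mr E1 E2 row_arr.
- by move=> a1 IH1 a2 IH2 /andP[/IH1 -> /IH2 ->]; rewrite addn1 Mr.
- by move=> a1 IH1 a2 IH2 /andP[/IH1 -> /IH2 ->].
- by move=> a1 IH1 a2 IH2 /andP[/IH1 -> /IH2 ->].
Qed.

Lemma sim_set_vr M s k x : 3 < k -> sim M s -> sim (update M 0 k x) (set_vr s k x).
Proof.
move=> k3 [Mv Mr]; split=> [k'|i j] /=; rewrite /update /=.
  by case: ifP.
have [k0 k1] : 0 <> k /\ 1 <> k by lia.
by rewrite Mr /mrow /= (introF eqP k0) (introF eqP k1).
Qed.

Lemma sim_set_ar M s k a b x : k < 8 -> sim M s ->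
  sim (update M (vr s 0 + vr s 1 + (8 * a + k)).+1 b x) (set_ar s k a b x).
Proof.
move=> k8 [Mv Mr]; split=> [k'|i j] /=; rewrite /update ?Mv // Mr /mrow /=.
set m := vr s 0 + vr s 1.
case: (ltnP i m) => im; first by rewrite ifN //; lia.
case: (eqVneq ((i - m) %% 8) k) => [<-|ne].
  congr (if _ && _ then _ else _); have := divn_eq (i - m) 8; lia.
rewrite ifN // negb_and; apply/orP; left; apply: contra ne => /eqP.
by case=> ->; rewrite addKn mulnC modnMDl modn_small.
Qed.

Lemma sim_set_ip M s a b x : a < vr s 0 + vr s 1 -> sim M s ->
  sim (update M a.+1 b x) (set_ip s a b x).
Proof.
move=> am [Mv Mr]; split=> [k'|i j] /=; rewrite /update ?Mv // Mr /mrow /= eqSS.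
case: (ltnP i) => im //; rewrite ifN //; lia.
Qed.

Definition tbnd (b : bnd) : {poly nat} :=
  (match b with BNum x => x%:P | _ => 'X end)%R.

Fixpoint tpoly (p : prog) : {poly nat} :=
  (match p with
   | PSkip | PSet _ _ | PArr _ _ _ _ => 1
   | POut _ _ _ => (2%N)%:P
   | PSeq p1 p2 | PIf _ p1 p2 => 1 + tpoly p1 + tpoly p2
   | PFor _ b p1 => (3%N)%:P + tbnd b * (tpoly p1 + (3%N)%:P)
   end)%R.

Lemma compile_correct p M s N : wf p -> sim M s -> vr s 0 <= N -> vr s 1 <= N ->
  exists t M', [/\ t <= (tpoly p).[N]%R, sim M' (den p s) &
    forall k w, iter t step (Config (compile p :: k) M w) = Config k M' w].
Proof.
elim: p M s => /=.
- by move=> M s _ Ms _ _; exists 1, M; split=> //; rewrite hornerC.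
- move=> k a M s /andP[k3 wa] Ms _ _; exists 1, (update M 0 k (ev s a)).
  split; [by rewrite hornerC | exact: sim_set_vr | ].
  by move=> k' w /=; rewrite (eval_cexp Ms).
- move=> k a1 a2 a3 M s /and4P[k8 w1 w2 w3] Ms _ _.
  exists 1, (update M (vr s 0 + vr s 1 + (8 * ev s a1 + k)).+1 (ev s a2) (ev s a3)).
  split; [by rewrite hornerC | exact: sim_set_ar | ].
  move=> k' w; rewrite /=.
  by rewrite (eval_arow _ _ Ms) !(eval_cexp Ms).
- move=> a1 a2 a3 M s /and3P[w1 w2 w3] Ms _ _; have [Mv _] := Ms.
  exists 2; case: ifP => lt.
    exists (update M (ev s a1).+1 (ev s a2) (ev s a3)); split.
    + by rewrite hornerC.
    + exact: sim_set_ip.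
    + by move=> k' w /=; rewrite !(eval_cexp Ms) // !Mv subn_eq0 leqNgt lt /= !(eval_cexp Ms) // addn1.
  exists M; split=> //; first by rewrite hornerC.
  by move=> k' w /=; rewrite !(eval_cexp Ms) // !Mv subn_eq0 leqNgt lt.
- move=> p1 IH1 p2 IH2 M s /andP[w1 w2] Ms n0 n1.
  have [t1 [M1 [T1 S1 R1]]] := IH1 _ _ w1 Ms n0 n1.
  have [| |t2 [M2 [T2 S2 R2]]] := IH2 _ _ w2 S1; rewrite ?den_vr ?wf_wvars //.
  exists (t2 + (t1 + 1)), M2; split=> //.
    rewrite !hornerD hornerC -/(tpoly _); change GRing.add with addn; lia.
  by move=> k w; rewrite !iterD /= R1 R2.
- move=> a p1 IH1 p2 IH2 M s /and3P[wa w1 w2] Ms n0 n1.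
  case: ifP => ea.
    have [t [M1 [T1 S1 R1]]] := IH2 _ _ w2 Ms n0 n1.
    exists (t + 1), M1; split=> //.
      rewrite !hornerD hornerC; change GRing.add with addn; lia.
    by move=> k w; rewrite iterD /= (eval_cexp Ms) // ea R1.
  have [t [M1 [T1 S1 R1]]] := IH1 _ _ w1 Ms n0 n1.
  exists (t + 1), M1; split=> //.
    rewrite !hornerD hornerC; change GRing.add with addn; lia.
  by move=> k w; rewrite iterD /= (eval_cexp Ms) // ea R1.
- move=> x b p IH M s /and3P[x3 xp wp] Ms n0 n1.
  set B := bval s b; set c := (tpoly p).[N]%R.
  set f := fun s' => set_vr (den p s') x (vr s' x).+1.
  have bN : B <= (tbnd b).[N]%R by rewrite /B; case: (b) => /= *; rewrite ?hornerC ?hornerX.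
  pose W := While (Defs.Sub (cbnd b) (rd x)) (Seq (compile p) (Store (Const 0) (Const x) (Add (rd x) (Const 1)))).
  have wv i y : y < 4 -> vr (iter i f (set_vr s x 0)) y = vr s y.
    move=> y4; elim: i => [|i IHi] /=; first by rewrite ifN //; lia.
    by rewrite ifN ?den_vr ?wf_wvars //; lia.
  have bW i M' : sim M' (iter i f (set_vr s x 0)) -> eval M' (cbnd b) = B.
    by case=> Mv _; rewrite /B; case: (b) => //=; rewrite Mv wv.
  have xi i : vr (iter i f (set_vr s x 0)) x = i.
    by elim: i => [|i IHi] /=; rewrite eqxx // IHi.
  have loop i : i <= B -> exists t M', [/\ t <= 2 + i * (c + 3),
      sim M' (iter i f (set_vr s x 0)) &
      forall k w, iter t step (Config (Seq (Store (Const 0) (Const x) (Const 0)) W :: k) M w) = Config (W :: k) M' w].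
    elim: i => [|i IHi] iB.
      by exists 2, (update M 0 x 0); split=> //; exact: sim_set_vr.
    have [t [M' [T S R]]] := IHi (ltnW iB).
    have [| |t2 [M2 [T2 S2 R2]]] := IH _ _ wp S; rewrite ?wv //.
    have S3 := sim_set_vr (vr (iter i f (set_vr s x 0)) x).+1 x3 S2.
    exists (1 + (t2 + (2 + t))), (update M2 0 x (vr (iter i f (set_vr s x 0)) x).+1).
    split=> //; first by rewrite -/c in T2; nia.
    move=> k w; rewrite iterD [iter (t2 + _) _ _]iterD [iter (2 + t) _ _]iterD R.
    have [Mv _] := S; have [Mv2 _] := S2.
    rewrite [iter 2 _ _]/= (bW _ _ S) Mv xi subn_eq0 leqNgt iB /= R2 /=.
    by rewrite Mv2 addn1 (den_vr _ xp) xi.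
  have [t [M' [T S R]]] := loop _ (leqnn B).
  exists (1 + t), M'; split=> //.
    rewrite hornerD hornerM hornerD !hornerC.
    have H : 1 + t <= 3 + B * (c + 3) by lia.
    apply: leq_trans H _.
    exact: (leq_add (leqnn 3) (leq_mul bN (leqnn (c + 3)))).
  move=> k w; rewrite iterD R /= (bW _ _ S); have [Mv _] := S.
  by rewrite Mv xi subnn.
Qed.

(** * Cuts and well-linked sets *)

Section Cut.
Variable V : finType.
Implicit Types (f : V -> V -> nat) (A B D K X : {set V}).

Definition capacity f A B : nat :=
  \sum_(p : V * V | (p.1 \in A) && (p.2 \in B)) f p.1 p.2.
Definition cut f A : nat := capacity f A (~: A).

Lemma capacityE f A B : capacity f A B =
  \sum_(p : V * V) (if (p.1 \in A) && (p.2 \in B) then f p.1 p.2 else 0).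
Proof. exact: big_mkcond. Qed.

Lemma capacity_sum f A B : capacity f A B = \sum_(u in A) \sum_(v in B) f u v.
Proof. by rewrite pair_big. Qed.

Lemma cut_submod f A B : cut f (A :|: B) + cut f (A :&: B) <= cut f A + cut f B.
Proof.
rewrite /cut !capacityE -!big_split /=; apply: leq_sum => -[u v] _ /=.
rewrite !inE.
by case: (u \in A); case: (u \in B); case: (v \in A); case: (v \in B) => //=; lia.
Qed.

Lemma cut_le f g A : (forall u v, f u v <= g u v) -> cut f A <= cut g A.
Proof. by move=> fg; apply: leq_sum. Qed.

Lemma capacity_setU f A B X : [disjoint B & X] ->
  capacity f A B + capacity f A X <= capacity f A (B :|: X).
Proof.
move=> BX; rewrite !capacityE -big_split /=; apply: leq_sum => -[u v] _ /=.
rewrite !inE; have := disjointFr BX (x := v).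
by case: (u \in A); case: (v \in B); case: (v \in X) => //= H; rewrite ?addn0 //; have := H isT.
Qed.

Lemma capacityS f A B X : B \subset X -> capacity f A B <= capacity f A X.
Proof.
move=> BX; rewrite !capacityE; apply: leq_sum => -[u v] _ /=.
have := subsetP BX v.
by case: (u \in A); case: (v \in B); case: (v \in X) => //= H; have := H isT.
Qed.

Lemma capacity_swap f A B : capacity f A B = capacity (fun u v => f v u) B A.
Proof.
rewrite /capacity (reindex (fun p => (p.2, p.1))) /=; last first.
  by exists (fun p => (p.2, p.1)) => -[].
by apply: eq_bigl => -[u v]; rewrite andbC.
Qed.

Lemma capacityC f A B : (forall u v, f u v = f v u) ->
  capacity f A B = capacity f B A.
Proof. by move=> fC; rewrite capacity_swap; apply: eq_bigr => p _; rewrite fC. Qed.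

Lemma cutC f A : (forall u v, f u v = f v u) -> cut f (~: A) = cut f A.
Proof. by move=> fC; rewrite /cut setCK capacityC. Qed.

Lemma cut_setU_disjoint f K X : (forall u v, f u v = f v u) ->
  [disjoint K & X] -> cut f K + cut f X <= cut f (K :|: X) + 2 * capacity f K X.
Proof.
move=> fC KX; rewrite mul2n -addnn {2}(capacityC K X fC) /cut !capacityE -!big_split /=.
apply: leq_sum => -[u v] _ /=; rewrite !inE.
have := disjointFr KX (x := u); have := disjointFr KX (x := v).
case: (u \in K); case: (u \in X); case: (v \in K); case: (v \in X) => //= H1 H2;
  try (by have := H1 isT); try (by have := H2 isT); lia.
Qed.

End Cut.

Section WellLinked.
Variables (V : finType) (e : rel V).
Hypothesis eC : symmetric e.
Hypothesis conn : forall u v : V, connect e u v.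
Hypothesis deg4 : forall v, degree e v <= 4.
Implicit Types (A B D K U X I S : {set V}).

Definition edge (u v : V) : nat := e u v.

Definition bridge (u v : V) : bool :=
  e u v && [exists D : {set V}, [&& u \in D, v \notin D & cut edge D <= 1]].

(* Bridges count twice; this makes every nontrivial cut have capacity at least
   2, while the cuts without bridges keep their size. *)
Definition edge2 (u v : V) : nat := e u v + bridge u v.

Lemma edgeC u v : edge u v = edge v u.
Proof. by rewrite /edge eC. Qed.

Lemma edge2C u v : edge2 u v = edge2 v u.
Proof.
suff br x y : bridge x y -> bridge y x.
  rewrite /edge2 eC; congr (_ + nat_of_bool _).
  by apply/idP/idP; exact: br.
rewrite /bridge eC => /andP[-> /existsP[D /and3P[xD yD D1]]] /=.
by apply/existsP; exists (~: D); rewrite !inE xD yD cutC //; exact: edgeC.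
Qed.

Lemma cut_edges A : cut edge A = #|edges_between e A (~: A)|.
Proof.
rewrite /cut /capacity -sum1_card big_mkcond [RHS]big_mkcond /=.
by apply: eq_bigr => -[u v] _; rewrite !inE /edge /=; case: (u \in A); case: (v \in A); case: (e u v).
Qed.

Lemma cut_edge_edge2 A : cut edge A <= cut edge2 A.
Proof. by apply: cut_le => u v; rewrite leq_addr. Qed.

Lemma cut_edge2_double A : cut edge2 A <= 2 * cut edge A.
Proof.
rewrite /cut /capacity big_distrr /=; apply: leq_sum => -[u v] _ /=.
by rewrite /edge2 /bridge /edge mul2n -addnn leq_add2l; case: (e u v); rewrite ?leq_b1.
Qed.

Lemma cut_gt0 A u v : u \in A -> v \notin A -> 0 < cut edge A.
Proof.
move=> uA vA; rewrite lt0n; apply: contra vA => /eqP A0.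
rewrite -(@closed_connect _ e (mem A) _ u v) //; apply: (intro_closed (sym_connect_sym eC)) => x y exy xA.
apply/negPn/negP => yA; move/eqP: A0; rewrite cut_edges cards_eq0 => /eqP/setP/(_ (x, y)).
by rewrite !inE xA exy andbT /= (negbTE yA).
Qed.

Lemma cut_edge2_ge2 A u v : u \in A -> v \notin A -> 2 <= cut edge2 A.
Proof.
move=> uA vA; have [A2|A1] := leqP 2 (cut edge A).
  by apply: leq_trans A2 _; exact: cut_edge_edge2.
have := cut_gt0 uA vA; rewrite cut_edges card_gt0 => /set0Pn[[x y]].
rewrite !inE /= => /and3P[xA yA exy].
rewrite /cut /capacity (bigD1 (x, y)) /= ?xA ?inE //.
suff: bridge x y by rewrite /edge2 exy => ->.
by rewrite /bridge exy; apply/existsP; exists A; rewrite xA yA -ltnS.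
Qed.

Lemma cut_edge2_card A : cut edge2 A <= 8 * #|A|.
Proof.
rewrite /cut capacity_sum -sum1_card big_distrr /=; apply: leq_sum => u _.
apply: (@leq_trans (\sum_v 2 * e u v)).
  rewrite big_mkcond /=; apply: leq_sum => v _.
  by case: ifP => // _; rewrite /edge2 /bridge; case: (e u v) => //=; case: [exists _, _].
rewrite -big_distrr /= -[8]/(2 * 4) -mulnA muln1 leq_mul2l /=.
apply: leq_trans (deg4 u); rewrite /degree -sum1_card [X in _ <= X]big_mkcond /=.
by apply: leq_sum => v _; rewrite inE; case: (e u v).
Qed.

Variables (T : {set V}) (q : nat).
Hypothesis q_gt0 : 0 < q.

Definition wt A : nat := #|A :&: T|.

Lemma wtS A B : A \subset B -> wt A <= wt B.
Proof. by move=> AB; apply: subset_leq_card; apply: setSI. Qed.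

Lemma wtU A B : wt (A :|: B) <= wt A + wt B.
Proof. by rewrite /wt setIUl; have := cardsUI (A :&: T) (B :&: T); lia. Qed.

Lemma wtD A B : wt (A :\: B) + wt (A :&: B) = wt A.
Proof.
by rewrite /wt -(cardsID B (A :&: T)) addnC -setIDAC setIAC.
Qed.

Lemma wtC A : wt A + wt (~: A) = #|T|.
Proof. by rewrite /wt -(cardsID A T) setIC; congr (_ + #|pred_of_set _|); rewrite setDE setIC. Qed.

(* The doubled demand turns the cut condition up to a factor 2 into the exact
   one: 2|I n A| <= (q edge2(A) + |A n T|)/q <= 2 edge(A) for bridgeless A. *)
Definition routable I : Prop :=
  forall A, 2 * q * #|I :&: A| <= q * cut edge2 A + wt A.

Lemma routable_card I : routable I -> 2 * q * #|I| <= #|T|.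
Proof.
move/(_ setT); rewrite setIT /wt setTI.
suff -> : cut edge2 setT = 0 by rewrite muln0.
by rewrite /cut /capacity big_pred0 // => p; rewrite !inE andbF.
Qed.

Lemma routable1 t : 2 * q <= #|T| -> routable [set t].
Proof.
move=> qT A; have [tA|tA] := boolP (t \in A); last first.
  by rewrite (_ : _ :&: A = set0) ?cards0 ?muln0 //; apply/setP => x; rewrite !inE; case: eqP => // ->; rewrite (negbTE tA).
rewrite (_ : _ :&: A = [set t]) ?cards1; last first.
  by apply/setP => x; rewrite !inE; case: eqP => // ->; rewrite tA.
have [A0|/set0Pn[v]] := boolP (~: A == set0).
  have -> : A = setT by rewrite -[A]setCK (eqP A0) setC0.
  by rewrite /wt setTI muln1 (leq_trans qT) // leq_addl.
rewrite inE => vA; have := cut_edge2_ge2 tA vA; nia.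
Qed.

Hypothesis wl : forall A, 2 * wt A <= #|T| -> 2 * wt A <= q * cut edge A.

Lemma cut_setD A D u v : u \in A -> v \notin A -> u \in D -> v \notin D ->
  e u v -> cut edge D <= 1 -> cut edge (A :\: D) < cut edge A.
Proof.
move=> uA vA uD vD euv; rewrite !cut_edges => D1.
have ED : edges_between e D (~: D) = [set (u, v)].
  apply/eqP; rewrite eq_sym eqEcard cards1 D1 andbT sub1set !inE /=.
  by rewrite uD vD.
apply: proper_card; apply/properP; split; last first.
  by exists (u, v); rewrite !inE /= ?uA ?vA ?uD.
apply/subsetP => -[x y]; rewrite !inE /= => /and3P[/andP[xD xA] yAD exy].
rewrite xA exy andbT /=; apply: contra yAD => yA; rewrite yA andbT.
apply/negP => yD; have : (y, x) \in edges_between e D (~: D).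
  by rewrite !inE /= yD xD eC.
by rewrite ED inE => /eqP[_ xv]; rewrite -xv xA in vA.
Qed.

Lemma cut_setU A D u v : u \in A -> v \notin A -> u \notin D -> v \in D ->
  e u v -> cut edge D <= 1 -> cut edge (A :|: D) < cut edge A.
Proof.
move=> uA vA uD vD euv D1.
rewrite -(cutC A edgeC) -(cutC (A :|: D) edgeC) setCU -setDE.
by apply: (@cut_setD _ D v u); rewrite ?inE ?uA ?vA // eC.
Qed.

Lemma routable_small_cut I A : routable I ->
  2 * wt A + q * cut edge A <= #|T| -> #|I :&: A| <= cut edge A.
Proof.
move=> Ir; have [m] := ubnP (cut edge A); elim: m A => // m IHm A Am AT.
have [br|nbr] := boolP [exists p : V * V, [&& p.1 \in A, p.2 \notin A & bridge p.1 p.2]]; last first.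
  have E : cut edge2 A = cut edge A.
    apply: eq_bigr => -[u v] /=; rewrite inE => /andP[uA vA].
    move/existsPn/(_ (u, v)): nbr; rewrite /= uA vA /= /edge2 => /negbTE->.
    by rewrite addn0.
  have := Ir A; have := wl (A := A); rewrite E; nia.
move/existsP: br => [[u v] /= /and3P[uA vA /andP[euv /existsP[D0 /and3P[uD0 vD0 D01]]]]].
have [D [D1 DT Duv]] : exists D, [/\ cut edge D <= 1, 2 * wt D <= #|T| &
    (u \in D) && (v \notin D) || (u \notin D) && (v \in D)].
  have [D0T|D0T] := leqP (2 * wt D0) #|T|; first by exists D0; rewrite uD0 vD0.
  exists (~: D0); rewrite !inE uD0 vD0 cutC ?orbT //; last exact: edgeC.
  by split=> //; have := wtC D0; lia.
have ID : #|I :&: D| <= 1.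
  have := Ir D; have := cut_edge2_double D; have := wl DT; nia.
case/orP: Duv => /andP[uD vD].
  have lt := cut_setD uA vA uD vD euv D1.
  have wA := wtS (subsetDl A D).
  have := IHm (A :\: D); have := cardsID D (I :&: A).
  have : #|I :&: A :&: D| <= #|I :&: D| by apply: subset_leq_card; rewrite setIAC subsetIl.
  rewrite setIDA; nia.
have lt := cut_setU uA vA uD vD euv D1.
have wA := wtU A D.
have := IHm (A :|: D); have := wl DT.
have : #|I :&: A| <= #|I :&: (A :|: D)| by apply: subset_leq_card; rewrite setIS // subsetUl.
nia.
Qed.

Lemma routable_well_linked I A : routable I ->
  minn #|A :&: I| #|~: A :&: I| <= cut edge A.
Proof.
move=> Ir; wlog AT : A / 2 * wt A <= #|T|.
  move=> H; have [AT|AT] := leqP (2 * wt A) #|T|; first exact: H.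
  rewrite minnC -{2}[A]setCK -(cutC A edgeC); apply: H.
  by have := wtC A; lia.
rewrite geq_min; apply/orP; left; rewrite leqNgt; apply/negP => lt.
have IA : #|A :&: I| <= #|I| by apply: subset_leq_card; exact: subsetIr.
have : #|A :&: I| <= cut edge A.
  rewrite setIC; apply: routable_small_cut => //.
  have := routable_card Ir; have := wl AT; clear -lt IA; nia.
by rewrite leqNgt lt.
Qed.

Lemma routable_extend I S : routable I -> S \subset T ->
  (32 * #|I| + 4) * q <= #|S| -> exists2 t, t \in S :\: I & routable (t |: I).
Proof.
move=> Ir ST IS; have ST' := subset_leq_card ST.
suff: [exists t in S :\: I, [forall A : {set V},
    2 * q * #|(t |: I) :&: A| <= q * cut edge2 A + wt A]].
  by case/exists_inP => t tS /forallP tr; exists t.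
apply: contraT => /exists_inPn nadd.
have small A : 2 * wt A <= #|T| -> 2 * wt A <= q * cut edge2 A.
  by move=> /wl wA; apply: leq_trans wA _; rewrite leq_mul2l cut_edge_edge2 orbT.
pose P K := (I \subset K) && (2 * wt K <= #|T|).
have PI : P I.
  rewrite /P subxx; have := routable_card Ir.
  have : wt I <= #|I| by apply: subset_leq_card; exact: subsetIl.
  nia.
have [K [PK K_min K_max]] : exists K, [/\ P K,
    forall K', P K' -> cut edge2 K <= cut edge2 K' &
    forall K', P K' -> K \subset K' -> K' <> K -> cut edge2 K < cut edge2 K'].
  case: (arg_minnP (cut edge2) PI) => K0 PK0 K0min.
  pose Q K := P K && (cut edge2 K == cut edge2 K0).
  have QK0 : Q K0 by rewrite /Q PK0 eqxx.
  case: (arg_maxnP (fun K : {set V} => #|K|) QK0) => K /andP[PK /eqP cK] Kmax.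
  exists K; split=> // K' PK'; first by rewrite cK K0min.
  move=> KK' neq; rewrite ltn_neqAle cK K0min // andbT.
  apply/eqP => cK'; apply: neq; apply/esym/eqP; rewrite eqEcard KK' /=.
  by apply: Kmax; rewrite /Q PK' cK' eqxx.
have cK : cut edge2 K <= 8 * #|I| by apply: leq_trans (K_min _ PI) (cut_edge2_card I).
have /andP[IK KT] := PK.
have rej t : t \in S :\: I -> exists A, [/\ t \in A,
    cut edge2 (K :|: A) <= (cut edge2 K).+1 & wt (A :\: K) <= (8 * #|I| + 2) * q].
  move=> tS; have /forallPn[A] := nadd _ tS; rewrite -ltnNge => lt; exists A.
  have tI : t \notin I by move: tS; rewrite inE => /andP[].
  have rA := Ir A; have rAK := Ir (A :&: K).
  have IAK : I :&: (A :&: K) = I :&: A.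
    by rewrite setIA; apply/setIidPl; apply: subset_trans (subsetIl _ _) IK.
  have sub := cut_submod edge2 K A.
  have tA : t \in A.
    apply/negPn/negP => tA; move: lt; rewrite setIUl (_ : [set t] :&: A = set0) ?set0U ?ltnNge ?rA //.
    by apply/setP => x; rewrite !inE; case: eqP => // ->; rewrite (negbTE tA).
  have c1 : #|(t |: I) :&: A| = #|I :&: A|.+1.
    rewrite setIUl (_ : [set t] :&: A = [set t]) ?cardsU1 ?inE ?(negbTE tI) //.
    by apply/setIidPl; rewrite sub1set.
  have wA := wtD A K.
  rewrite (setIC K A) in sub; rewrite IAK in rAK; move: lt; rewrite c1 => lt.
  have key : q * cut edge2 (K :|: A) + wt (A :\: K) < q * cut edge2 K + 2 * q by nia.
  split=> //; first by rewrite -ltnS; nia.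
  nia.
pose Q U := [&& K \subset U, 2 * wt U <= #|T| &
  cut edge2 U + capacity edge2 K (~: U) <= 2 * cut edge2 K].
have QK : Q K by rewrite /Q subxx KT mul2n -addnn leqnn.
case: (arg_maxnP (fun U : {set V} => #|U|) QK) => U /and3P[KU UT cU] Umax.
have wU : wt U <= 8 * q * #|I| by have := small _ UT; nia.
suff SU : S \subset U.
  have : #|S| <= wt U by rewrite -[S](setIidPl ST) (subset_leq_card (setSI _ SU)).
  nia.
apply/subsetP => t tS; apply/negPn/negP => tU.
have [|A [tA cA wA]] := rej t.
  by rewrite inE tS andbT; apply: contra tU => /(subsetP IK) /(subsetP KU).
suff: Q (U :|: A).
  move/Umax; apply/negP; rewrite -ltnNge; apply: proper_card; apply/properP.
  by split; [exact: subsetUl | exists t; rewrite ?inE ?tA ?orbT].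
have KUA : K \subset U :|: A by rewrite (subset_trans KU) ?subsetUl.
have wUA : wt (U :|: A) <= wt U + wt (A :\: K).
  apply: leq_trans (wtU _ _); apply: wtS; apply/subsetP => x; rewrite !inE.
  by case xK: (x \in K) => //=; rewrite (subsetP KU).
have UAT : 2 * wt (U :|: A) <= #|T| by clear -wUA wU wA IS ST'; nia.
rewrite /Q KUA UAT /=.
have := cut_submod edge2 U (K :|: A).
have -> : U :|: (K :|: A) = U :|: A by rewrite setUA (setUidPl KU).
set Y := U :&: (K :|: A) => sub.
have KY : K \subset Y by rewrite subsetI KU subsetUl.
have [YK|/eqP neq] := eqVneq Y K; last first.
  have PY : P Y.
    by rewrite /P (subset_trans IK KY); rewrite (leq_trans _ UT) // leq_mul2l wtS // subsetIl.
  have := K_max _ PY KY neq.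
  have : capacity edge2 K (~: (U :|: A)) <= capacity edge2 K (~: U).
    by apply: capacityS; rewrite setCS subsetUl.
  clear -sub cA cU; lia.
have tK : t \notin K by apply: contra tU; exact: (subsetP KU).
have KX : [disjoint K & A :\: K] by rewrite -setI_eq0 setIDA setDIl setDv set0I.
have := cut_setU_disjoint edge2C KX; rewrite (_ : K :|: A :\: K = K :|: A); last first.
  by apply/setP => x; rewrite !inE; case: (x \in K).
have [v vX] : exists v, v \notin A :\: K.
  apply/existsP; apply: contraT => /existsPn XT.
  have E : A :\: K = setT.
    by apply/setP => x; rewrite [RHS]inE; have := XT x; rewrite negbK.
  move: wA; rewrite E /wt setTI => wA; clear -wA IS ST' q_gt0; nia.
have tX : t \in A :\: K by rewrite inE tK.
have := cut_edge2_ge2 tX vX.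
have : [disjoint ~: (U :|: A) & A :\: K].
  by rewrite -setI_eq0; apply/eqP/setP => x; rewrite !inE; case: (x \in A); rewrite ?orbT ?andbF.
move=> /(capacity_setU edge2 K).
have : capacity edge2 K (~: (U :|: A) :|: A :\: K) <= capacity edge2 K (~: U).
  apply: capacityS; apply/subsetP => x; rewrite !inE => /orP[|/andP[xK xA]].
    by case: (x \in U).
  apply/negP => xU; move/setP: YK => /(_ x).
  by rewrite !inE xU xA orbT (negbTE xK).
rewrite YK in sub.
clear -sub cA cU; lia.
Qed.

End WellLinked.

(** * Routing by unit push-relabel *)

Notation nV := 0 (only parsing).
Notation rV := 1 (only parsing).
Notation numV := 2 (only parsing).
Notation denV := 3 (only parsing).
Notation qV := 4 (only parsing).
Notation accV := 5 (only parsing).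
Notation failV := 6 (only parsing).
Notation movedV := 7 (only parsing).
Notation startV := 8 (only parsing).
Notation foundV := 9 (only parsing).
Notation uV := 11 (only parsing).
Notation vV := 12 (only parsing).
Notation xV := 30 (only parsing).
Notation yV := 31 (only parsing).
Notation roundV := 32 (only parsing).
Notation jV := 33 (only parsing).
Notation tV := 34 (only parsing).
Notation capA := 0 (only parsing).
Notation resA := 1 (only parsing).
Notation hA := 2 (only parsing).
Notation exA := 3 (only parsing).
Notation skA := 4 (only parsing).
Notation termA := 5 (only parsing).
Notation demA := 6 (only parsing).
Notation selA := 7 (only parsing).

Lemma den_for (Inv : nat -> state -> Prop) k b p s N : bval s b = N ->
  Inv 0 (set_vr s k 0) ->
  (forall i s', i < N -> vr s' k = i -> Inv i s' ->
     Inv i.+1 (set_vr (den p s') k i.+1)) ->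
  Inv N (den (PFor k b p) s).
Proof.
move=> /= -> Inv0 step_Inv.
set f := fun s' => _; set s0 := set_vr s k 0.
suff H i : i <= N -> vr (iter i f s0) k = i /\ Inv i (iter i f s0) by have [] := H N.
elim: i => [|i IHi] iN; first by rewrite /s0 /= eqxx.
have [vi Ii] := IHi (ltnW iN); rewrite /= {1}/f /= eqxx vi; split=> //.
by rewrite /f vi; apply: step_Inv.
Qed.

Lemma den_if a p1 p2 s :
  den (PIf a p1 p2) s = if ev s a == 0 then den p2 s else den p1 s.
Proof. by []. Qed.

Lemma den_ifT a p1 p2 s : ev s a != 0 -> den (PIf a p1 p2) s = den p1 s.
Proof. by rewrite den_if => /negbTE->. Qed.

Lemma den_ifF a p1 p2 s : ev s a = 0 -> den (PIf a p1 p2) s = den p2 s.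
Proof. by rewrite den_if => ->. Qed.

Definition azero := ANum 0.
Definition aone := ANum 1.
Definition seqs (ps : seq prog) : prog := foldr PSeq PSkip ps.
Lemma den_seqs p ps s : den (seqs (p :: ps)) s = den (seqs ps) (den p s).
Proof. by []. Qed.

Lemma den_seqs0 s : den (seqs [::]) s = s.
Proof. by []. Qed.

Definition denE := (den_if, den_seqs, den_seqs0).

Definition pwhen a p := PIf a p PSkip.
Definition punless a p := PIf a PSkip p.
Definition incr k a b := PArr k a b (AAdd (AArr k a b) aone).
Definition decr k a b := PArr k a b (ASub (AArr k a b) aone).

(* Unit push-relabel with the sink kept implicit: sk u is the residual capacity
   from u to the sink, and a vertex of height n is given up. *)
Definition push1 : prog :=
  punless (AVar movedV) (pwhen (AArr resA (AVar uV) (AVar vV))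
    (pwhen (ASub (AArr hA (AVar uV) azero) (AArr hA (AVar vV) azero))
      (seqs [:: decr resA (AVar uV) (AVar vV); incr resA (AVar vV) (AVar uV);
                decr exA (AVar uV) azero; incr exA (AVar vV) azero; PSet movedV aone]))).
Definition push : prog := PFor vV BVerts push1.
Definition discharge : prog :=
  pwhen (AArr exA (AVar uV) azero) (pwhen (ASub (AVar nV) (AArr hA (AVar uV) azero))
    (PIf (AArr skA (AVar uV) azero)
      (seqs [:: decr skA (AVar uV) azero; decr exA (AVar uV) azero])
      (seqs [:: PSet movedV azero; push;
                punless (AVar movedV) (incr hA (AVar uV) azero)]))).
Definition sweep : prog := PFor uV BVerts discharge.
Definition sweeps : prog :=
  PFor 20 (BNum 6) (PFor 21 BVerts (PFor 22 BVerts (PFor 23 BVerts (PFor 24 BVerts sweep)))).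
Definition route : prog :=
  seqs [:: PFor uV BVerts (PArr hA (AVar uV) azero azero); sweeps; PSet failV azero;
           PFor uV BVerts (pwhen (AArr exA (AVar uV) azero) (PSet failV aone))].

Lemma sum_change n (f g : nat -> nat) u : u < n -> (forall i, i != u -> g i = f i) ->
  \sum_(i < n) g i + f u = \sum_(i < n) f i + g u.
Proof.
move=> un gf; rewrite (bigD1 (Ordinal un)) //= [in RHS](bigD1 (Ordinal un)) //=.
rewrite (eq_bigr (fun i : 'I_n => f i)); first by lia.
by move=> i iu; apply: gf; apply: contra iu => /eqP iu; apply/eqP/val_inj.
Qed.

Lemma sum_change2 n (f g : nat -> nat) u v : u < n -> v < n -> u != v ->
  (forall i, i != u -> i != v -> g i = f i) ->
  \sum_(i < n) g i + f u + f v = \sum_(i < n) f i + g u + g v.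
Proof.
move=> un vn uv gf.
pose h i := if i == u then g u else f i.
have := @sum_change n f h u un; have := @sum_change n h g v vn.
rewrite /h eqxx eq_sym (negbTE uv) => H1 H2.
have {}H2 := H2 (fun i iu => ltac:(by rewrite (negbTE iu))).
have {}H1 := H1 (fun i iv => ltac:(by case: (eqVneq i u) => [->|iu] //; apply: gf)).
lia.
Qed.

Section Flow.
Variables (n : nat) (c : nat -> nat -> nat) (d s0 : nat -> nat).

Definition excess (s : state) : nat := \sum_(u < n) ar s exA u 0.

Record flow_inv (s : state) : Prop := FlowInv {
  flow_n : vr s nV = n;
  flow_res : forall u v, u < n -> v < n -> ar s resA u v + ar s resA v u = 2 * c u v;
  flow_cons : forall u, u < n ->
    ar s exA u 0 + s0 u + \sum_(v < n) c u v
      = d u + ar s skA u 0 + \sum_(v < n) ar s resA u v;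
  flow_label : forall u v, u < n -> v < n -> 0 < ar s resA u v ->
    ar s hA u 0 <= (ar s hA v 0).+1;
  flow_sink : forall u, u < n -> 0 < ar s skA u 0 -> ar s hA u 0 = 0;
  flow_height : forall u, u < n -> ar s hA u 0 <= n;
  flow_excess : excess s <= 2 * n * n }.

(* A push lowers the second sum; a relabelling raises it by at most 2 n^2, but
   lowers the first sum.  Hence 6 n^4 sweeps leave no active vertex. *)
Definition potential (s : state) : nat :=
  (2 * n * n).+1 * \sum_(u < n) (n - ar s hA u 0)
  + \sum_(u < n) ar s exA u 0 * ar s hA u 0 + excess s.

Definition quiet (s : state) : Prop :=
  forall u, u < n -> 0 < ar s exA u 0 -> n <= ar s hA u 0.

Lemma flow_inv_ar s s' : vr s' nV = vr s nV -> ar s' = ar s -> flow_inv s -> flow_inv s'.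
Proof. by case: s s' => v a i [v' a' i'] /= E -> [? ? ? ? ? ? ?]; split=> //=; rewrite E. Qed.

Lemma potential_ar s s' : ar s' = ar s -> potential s' = potential s.
Proof. by rewrite /potential /excess => ->. Qed.

Lemma push_step s s' u v : flow_inv s -> u < n -> v < n -> 0 < ar s exA u 0 ->
  0 < ar s resA u v -> ar s hA v 0 < ar s hA u 0 -> vr s' nV = vr s nV ->
  ar s' hA = ar s hA -> ar s' skA = ar s skA ->
  (forall x y, ar s' resA x y = if (x == u) && (y == v) then ar s resA u v - 1
     else if (x == v) && (y == u) then ar s resA v u + 1 else ar s resA x y) ->
  (forall x, ar s' exA x 0 = if x == u then ar s exA u 0 - 1
     else if x == v then ar s exA v 0 + 1 else ar s exA x 0) ->
  flow_inv s' /\ potential s' < potential s.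
Proof.
move=> Fs un vn exu ruv huv En Eh Esk Eres Eex.
have [Fn F1 F2 F3 F4 F5 F6] := Fs.
have uv : u != v by apply/eqP => uv; rewrite uv ltnn in huv.
have vu : (v == u) = false by rewrite eq_sym; exact: negbTE.
have ex_sum : excess s' = excess s.
  have := @sum_change2 n (fun x => ar s exA x 0) (fun x => ar s' exA x 0) u v un vn uv.
  rewrite /excess /= !Eex eqxx vu eqxx => H.
  have {}H := H (fun i iu iv => ltac:(by rewrite Eex (negbTE iu) (negbTE iv))).
  lia.
split.
  split; rewrite ?En ?Eh ?Esk ?ex_sum //.
  - move=> x y xn yn; rewrite !Eres; have := F1 _ _ xn yn; have := F1 _ _ un vn.
    case: (eqVneq x u) => [->|xu]; case: (eqVneq y v) => [->|yv] //=; rewrite ?andbF ?andbT /=.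
    + rewrite ?vu ?(negbTE uv) /= ?eqxx /=; lia.
    + by rewrite ?(negbTE uv) /=; case: (y == u); rewrite ?eqxx ?andbF ?(negbTE yv).
    + by rewrite ?vu /= ?eqxx; case: (x == v); rewrite /= ?(negbTE xu).
    + case: (eqVneq x v) => [->|xv]; case: (eqVneq y u) => [->|yu] //=; rewrite ?andbF //=.
      by rewrite ?eqxx; lia.
  - move=> x xn; have := F2 _ xn; rewrite Eex.
    have [->|xu] := eqVneq x u.
      have := @sum_change n (ar s resA u) (ar s' resA u) v vn.
      rewrite Eres !eqxx /= => H.
      have {}H := H (fun i iv => ltac:(by rewrite Eres (negbTE iv) andbF (negbTE uv))).
      lia.
    have [->|xv] := eqVneq x v.
      have := @sum_change n (ar s resA v) (ar s' resA v) u un.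
      rewrite Eres !eqxx vu /= => H.
      have {}H := H (fun i iu => ltac:(by rewrite Eres (negbTE iu) andbF vu)).
      lia.
    by move=> ->; congr (_ + _); apply: eq_bigr => y _; rewrite Eres (negbTE xu) (negbTE xv).
  - move=> x y xn yn; rewrite Eres.
    case: ifP => [/andP[/eqP-> /eqP->] _|_]; first exact: F3.
    case: ifP => [/andP[/eqP-> /eqP->] _|_]; [lia | exact: F3].
rewrite /potential ex_sum Eh ltn_add2r ltn_add2l.
have := @sum_change2 n (fun x => ar s exA x 0 * ar s hA x 0) (fun x => ar s' exA x 0 * ar s hA x 0) u v un vn uv.
rewrite /= !Eex eqxx vu eqxx => H.
have {}H := H (fun i iu iv => ltac:(by rewrite Eex (negbTE iu) (negbTE iv))).
nia.
Qed.

Lemma sink_step s s' u : flow_inv s -> u < n -> 0 < ar s exA u 0 ->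
  0 < ar s skA u 0 -> vr s' nV = vr s nV ->
  ar s' hA = ar s hA -> ar s' resA = ar s resA ->
  (forall x, ar s' skA x 0 = if x == u then ar s skA u 0 - 1 else ar s skA x 0) ->
  (forall x, ar s' exA x 0 = if x == u then ar s exA u 0 - 1 else ar s exA x 0) ->
  flow_inv s' /\ potential s' < potential s.
Proof.
move=> [Fn F1 F2 F3 F4 F5 F6] un exu sku En Eh Eres Esk Eex.
have ex_sum : excess s' + 1 = excess s.
  have := @sum_change n (fun x => ar s exA x 0) (fun x => ar s' exA x 0) u un.
  rewrite /excess /= !Eex eqxx => H.
  have {}H := H (fun i iu => ltac:(by rewrite Eex (negbTE iu))).
  lia.
split.
  split; rewrite ?En ?Eh ?Eres //.
  - move=> x xn; have := F2 _ xn; rewrite Eex Esk.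
    by case: eqP => // ->; lia.
  - by move=> x xn; rewrite Esk; case: eqP => [->|_ ?] *; exact: F4.
  - lia.
rewrite /potential Eh -ex_sum addn1 addnS ltnS leq_add2r leq_add2l.
apply: leq_sum => i _; rewrite Eex; case: eqP => // ->.
by rewrite leq_mul2r leq_subr orbT.
Qed.

Lemma relabel_step s s' u : flow_inv s -> u < n -> 
  ar s skA u 0 = 0 -> ar s hA u 0 < n ->
  (forall v, v < n -> 0 < ar s resA u v -> ar s hA u 0 <= ar s hA v 0) ->
  vr s' nV = vr s nV -> ar s' skA = ar s skA -> ar s' resA = ar s resA ->
  ar s' exA = ar s exA ->
  (forall x, ar s' hA x 0 = if x == u then ar s hA u 0 + 1 else ar s hA x 0) ->
  flow_inv s' /\ potential s' < potential s.
Proof.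
move=> [Fn F1 F2 F3 F4 F5 F6] un sku hun hmin En Esk Eres Eex Eh.
have exu : ar s exA u 0 <= 2 * n * n.
  by apply: leq_trans F6; rewrite /excess (bigD1 (Ordinal un)) //= leq_addr.
split.
  split; rewrite ?En ?Esk ?Eres ?Eex /excess ?Eex //.
  - move=> x y xn yn rxy; rewrite !Eh; have := F3 _ _ xn yn rxy.
    by case: (eqVneq x u) => [xu|_]; case: (eqVneq y u) => [yu|_]; subst; try lia; have := hmin _ yn rxy; lia.
  - by move=> x xn; rewrite Eh; case: (eqVneq x u) => [->|_]; [rewrite sku | exact: F4].
  - by move=> x xn; rewrite Eh; case: eqP => _; [rewrite addn1 | exact: F5].
have := @sum_change n (fun x => n - ar s hA x 0) (fun x => n - ar s' hA x 0) u un.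
have := @sum_change n (fun x => ar s exA x 0 * ar s hA x 0) (fun x => ar s exA x 0 * ar s' hA x 0) u un.
rewrite /= Eh eqxx => H1 H2.
have {}H1 := H1 (fun i iu => ltac:(by rewrite Eh (negbTE iu))).
have {}H2 := H2 (fun i iu => ltac:(by rewrite Eh (negbTE iu))).
rewrite /potential /excess Eex; move: H1 H2; set P := \sum_(i < n) (n - _).
set P' := \sum_(i < n) (n - _); rewrite mulnDr muln1 => H1 H2.
have -> : P' = P.+1 by lia.
rewrite mulnS; move: (_.+1 * P) H1 exu => a.
set x := \sum_(i < n) _; set y := \sum_(i < n) _; move: x y (\sum_(i < n) _) => x y w.
clear; lia.
Qed.

Lemma push_spec s u : flow_inv s -> vr s uV = u -> u < n ->
  0 < ar s exA u 0 -> vr s movedV = 0 -> let s' := den push s in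
  (vr s' movedV = 0 /\ ar s' = ar s /\
     forall v, v < n -> 0 < ar s resA u v -> ar s hA u 0 <= ar s hA v 0) \/
  (vr s' movedV != 0 /\ flow_inv s' /\ potential s' < potential s).
Proof.
move=> Fs su un exu s7.
pose Inv i s' := vr s' nV = n /\ vr s' uV = u /\
  ((vr s' movedV = 0 /\ ar s' = ar s /\
     forall v, v < i -> 0 < ar s resA u v -> ar s hA u 0 <= ar s hA v 0) \/
   (vr s' movedV != 0 /\ flow_inv s' /\ potential s' < potential s)).
suff [_ []] : Inv n (den push s) by [].
apply: (den_for (Inv := Inv)).
- exact: flow_n Fs.
- by split; [exact: flow_n Fs | split=> //; left].
move=> i s' iN s'i [s'n [s'u H]]; rewrite /push1 /punless /pwhen.
rewrite [den _ _]/=; case: H => [[m0 [As hv]]|[m0 [Fs' Ps]]]; last first.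
  rewrite (negbTE m0); split=> //; split=> //; right; split=> //.
  by split; [exact: (@flow_inv_ar s') | rewrite (@potential_ar s')].
rewrite m0 /= s'u s'i As.
have [r0|r0] := eqVneq (ar s resA u i) 0.
  split=> //; split=> //; left; split=> //; split=> // v.
  by rewrite ltnS leq_eqVlt => /orP[/eqP->|/hv//]; rewrite r0.
have [h0|h0] := eqVneq (ar s hA u 0 - ar s hA i 0) 0.
  split=> //; split=> //; left; split=> //; split=> // v.
  by rewrite ltnS leq_eqVlt => /orP[/eqP-> _|/hv//]; rewrite -subn_eq0 h0.
have iu : (i == u) = false by apply/eqP => iu; rewrite iu subnn in h0.
have ui : (u == i) = false by rewrite eq_sym.
split=> //; split=> //; right; split=> //.
have Fs' : flow_inv s' by apply: (flow_inv_ar _ As Fs); rewrite s'n (flow_n Fs).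
rewrite -(@potential_ar s s') //.
apply: (@push_step s' _ u i) => //=; rewrite ?As ?lt0n //; try lia.
- by move=> x y; rewrite /= /update iu ui !andbF /= ?eqxx; case: (eqVneq x u) => [->|xu]; rewrite ?ui //=; case: (eqVneq x i) => //= _; case: (y == u).
- by move=> x; rewrite /= /update eqxx ?andbT iu /=; case: (eqVneq x i) => [->|xi]; rewrite ?iu ?ui //=; rewrite andbT.
Qed.

Lemma discharge_spec s u : flow_inv s -> vr s uV = u -> u < n ->
  let s' := den discharge s in
  [/\ flow_inv s', vr s' uV = u,
      (0 < ar s exA u 0 -> n <= ar s hA u 0) -> ar s' = ar s &
      potential s' < potential s \/ ar s' = ar s /\ (0 < ar s exA u 0 -> n <= ar s hA u 0)].
Proof.
move=> Fs su un s'; have Fn := flow_n Fs.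
have s'u : vr s' uV = u by rewrite den_vr.
rewrite /s' /discharge /pwhen /punless !denE.
set s1 := den push _; rewrite /= su Fn.
have [e0|e0] := eqVneq (ar s exA u 0) 0.
  by split=> //; right; split=> //; rewrite e0.
have [h0|h0] := eqVneq (n - ar s hA u 0) 0.
  by split=> //; right; split=> // _; rewrite -subn_eq0 h0.
have quietN : (0 < ar s exA u 0 -> n <= ar s hA u 0) -> False by rewrite lt0n => /(_ e0); lia.
have [k0|k0] := eqVneq (ar s skA u 0) 0; last first.
  set s2 := set_ar (set_ar s skA u 0 (ar s skA u 0 - 1)) exA u 0 (ar s exA u 0 - 1).
  have [F P] : flow_inv s2 /\ potential s2 < potential s.
    apply: (@sink_step s s2 u) => //; rewrite ?lt0n //.
    - by move=> x; rewrite /= /update andbT.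
    - by move=> x; rewrite /= /update andbT.
  rewrite su /=; split=> //; by left.
have F1 : flow_inv (set_vr s movedV 0) by apply: flow_inv_ar Fs.
have exu : 0 < ar s exA u 0 by rewrite lt0n.
have := push_spec F1 su un exu erefl.
rewrite [den push _](_ : _ = s1) //= => H.
have s1u : vr s1 uV = u by rewrite /s1 den_vr.
case: H => [[m0 [As hv]]|[m0 [F P]]]; last first.
  rewrite (negbTE m0); split=> //; by left.
rewrite m0 /= s1u.
set s2 := set_ar s1 hA u 0 (ar s1 hA u 0 + 1).
have [F P] : flow_inv s2 /\ potential s2 < potential s.
  apply: (@relabel_step s s2 u) => //=; rewrite ?As //.
  - lia.
  - by rewrite /s1 den_vr.
  - by move=> x; rewrite /update andbT.
split=> //; by left.
Qed.

Lemma sweep_spec s : flow_inv s -> let s' := den sweep s in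
  [/\ flow_inv s', quiet s -> ar s' = ar s & potential s' < potential s \/ quiet s'].
Proof.
move=> Fs.
pose Inv i s' := [/\ flow_inv s', quiet s -> ar s' = ar s & potential s' < potential s \/
  ar s' = ar s /\ forall u, u < i -> 0 < ar s exA u 0 -> n <= ar s hA u 0].
suff [F Q P] : Inv n (den sweep s).
  by split=> //; case: P => [|[E H]]; [left | right=> u un; rewrite E; exact: H].
apply: (den_for (Inv := Inv)).
- exact: flow_n Fs.
- split=> //; last by right.
  exact: flow_inv_ar Fs.
move=> i s' iN s'i [F Q P].
have [F' s'u Q' P'] := discharge_spec F s'i iN.
split=> /=.
- exact: flow_inv_ar F'.
- by move=> q; rewrite Q' ?Q //; exact: q.
rewrite -/(potential _); have E x : potential (set_vr (den discharge s') uV x) = potential (den discharge s') by [].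
rewrite E; case: P => [lt|[As H]]; first last.
  case: P' => [lt|[As' H']]; first by left; rewrite -(potential_ar As).
  rewrite As in H' As'; right; split=> // u.
  by rewrite ltnS leq_eqVlt => /orP[/eqP->|/H].
left; case: P' => [lt'|[As' _]]; first exact: ltn_trans lt.
by rewrite (potential_ar As').
Qed.

Lemma for_iter (Q : nat -> state -> Prop) k b p N D :
  (forall m s, Q m s -> bval s b = N) -> (forall m s x, Q m s -> Q m (set_vr s k x)) ->
  (forall m s, Q m s -> Q (m + D) (den p s)) ->
  forall m s, Q m s -> Q (m + N * D) (den (PFor k b p) s).
Proof.
move=> Qb Qk Qp m s Qs; apply: (den_for (Inv := fun i s' => Q (m + i * D) s')).
- exact: Qb Qs.
- by rewrite addn0; exact: Qk.
- by move=> i s' _ _ Qi; apply: Qk; rewrite mulSn [D + _]addnC addnA; exact: Qp.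
Qed.

Lemma sweeps_spec s : 0 < n -> flow_inv s ->
  potential s < 6 * (n * (n * (n * n))) -> 
  flow_inv (den sweeps s) /\ quiet (den sweeps s).
Proof.
move=> n0 Fs Ps.
pose Q m s' := flow_inv s' /\ (quiet s' \/ potential s' + m <= potential s).
have Qk k m s' x : 3 < k -> Q m s' -> Q m (set_vr s' k x).
  case: k => // k k3 [F P]; split; last exact: P.
  exact: flow_inv_ar F.
have Qn m s' : Q m s' -> bval s' BVerts = n by case=> F _; exact: flow_n F.
suff [F [|H]] : Q (0 + 6 * (n * (n * (n * (n * 1))))) (den sweeps s).
- by split.
- by exfalso; move: H Ps; rewrite muln1; clear; lia.
have Q0 : Q 0 s by split=> //; right; rewrite addn0.
have Q1 m s' : Q m s' -> Q (m + 1) (den sweep s').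
  case=> F P; have [F' q P'] := sweep_spec F; split=> //.
  case: P => [/q E|P]; last by case: P' => [P'|P']; [right; clear -P P'; lia | left].
  by case: P' => [|]; [rewrite (potential_ar E) ltnn | left].
suff H m s' : Q m s' -> Q (m + 6 * (n * (n * (n * (n * 1))))) (den sweeps s') by exact: H.
move: m s'; do 5! (apply: for_iter; [by [] || exact: Qn | by move=> *; apply: Qk | ]).
exact: Q1.
Qed.

Definition feasible : Prop := forall A : {set 'I_n},
  \sum_(u in A) d u <= cut (fun u v : 'I_n => c u v) A + \sum_(u in A) s0 u.

Lemma flow_balance s (A : {set 'I_n}) : flow_inv s ->
  \sum_(u in A) d u + \sum_(u in A) ar s skA u 0
    + capacity (fun u v : 'I_n => ar s resA u v) A (~: A)
  = \sum_(u in A) ar s exA u 0 + \sum_(u in A) s0 u + cut (fun u v : 'I_n => c u v) A.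
Proof.
move=> [_ F1 F2 _ _ _ _]; rewrite /cut !capacity_sum.
have splitA (f : 'I_n -> 'I_n -> nat) : \sum_(u in A) \sum_v f u v =
    capacity f A A + \sum_(u in A) \sum_(v in ~: A) f u v.
  rewrite capacity_sum -big_split /=; apply: eq_bigr => u _.
  rewrite (bigID (mem A)) /=; congr (_ + _).
  by apply: eq_bigl => v; rewrite inE.
have inner : capacity (fun u v : 'I_n => ar s resA u v) A A =
    capacity (fun u v : 'I_n => c u v) A A.
  apply/eqP; rewrite -(eqn_pmul2l (m := 2)) // {1}mul2n -addnn; apply/eqP.
  rewrite {2}capacity_swap /capacity.
  by rewrite -big_split big_distrr /=; apply: eq_bigr => -[u v] _; rewrite /= F1.
have : \sum_(u in A) (ar s exA u 0 + s0 u + \sum_(v < n) c u v) =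
    \sum_(u in A) (d u + ar s skA u 0 + \sum_(v < n) ar s resA u v).
  by apply: eq_bigr => u _; apply: F2.
have := splitA (fun u v : 'I_n => ar s resA u v); have := splitA (fun u v : 'I_n => c u v).
rewrite !big_split inner /=; move: (capacity _ A A) => x ->.
move=> ->; set a := \sum_(u in A) \sum_(v in ~: A) c u v.
set b := \sum_(u in A) \sum_(v in ~: A) _; set f := \sum_(u in A) ar s exA u 0.
set g := \sum_(u in A) s0 u; set h := \sum_(u in A) d u; set k := \sum_(u in A) _.
by move: a b f g h k; clear; lia.
Qed.

(* If some vertex reaches height n, one of the heights 0, ..., n - 1 is missing,
   and the vertices above the missing height form a saturated cut. *)
Lemma height_gap (h : 'I_n -> nat) u : h u = n -> exists2 k, k < n & forall v, h v != k.
Proof.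
move=> hu.
have [/forallP H|] := boolP [forall k : 'I_n, [exists v, h v == k]]; last first.
  by case/forallPn => k /existsPn H; exists k.
have : size (iota 0 n.+1) <= size [seq h v | v <- enum 'I_n].
  apply: uniq_leq_size; first exact: iota_uniq.
  move=> k; rewrite mem_iota /= add0n ltnS leq_eqVlt => /orP[/eqP->|kn].
    by apply/mapP; exists u; rewrite ?mem_enum ?hu.
  by have /existsP[v /eqP hv] := H (Ordinal kn); apply/mapP; exists v; rewrite ?mem_enum ?hv.
by rewrite size_iota size_map size_enum_ord ltnn.
Qed.

Lemma flow_decide s : flow_inv s -> quiet s ->
  (forall u, u < n -> ar s exA u 0 = 0) <-> feasible.
Proof.
move=> Fs qs; split=> [ex0 A|feas u un].
  have := flow_balance A Fs; rewrite [\sum_(u in A) ar s exA u 0]big1; first by lia.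
  by move=> u _; apply: ex0.
apply/eqP; rewrite -leqn0 leqNgt; apply/negP => exu.
have [_ _ _ F3 F4 F5 _] := Fs.
pose h (v : 'I_n) := ar s hA v 0.
have [|k kn hk] := @height_gap h (Ordinal un).
  by apply/eqP; rewrite eqn_leq F5 //= qs.
pose A := [set v | k < h v].
have := flow_balance A Fs; have := feas A.
rewrite [\sum_(v in A) ar s skA v 0]big1; last first.
  move=> v; rewrite inE => kv; apply/eqP; rewrite -leqn0 leqNgt; apply/negP => skv.
  by move: kv; rewrite /h F4.
rewrite [capacity _ A _]big1; last first.
  move=> [v w] /=; rewrite !inE -leqNgt => /andP[kv wk].
  apply/eqP; rewrite -leqn0 leqNgt; apply/negP => rvw.
  have := F3 _ _ (ltn_ord v) (ltn_ord w) rvw; rewrite -/(h v) -/(h w).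
  have := hk w; lia.
have uA : Ordinal un \in A by rewrite inE /h /=; apply: leq_trans kn _; exact: qs.
have : 0 < \sum_(v in A) ar s exA v 0 by rewrite (bigD1 (Ordinal un)) //= addn_gt0 exu.
set x := \sum_(v in A) ar s exA v 0; set y := cut _ _.
set a := \sum_(v in A) d v; set b := \sum_(v in A) s0 v.
by move: x y a b; clear; lia.
Qed.
End Flow.

Lemma route_spec n c d s0 s : 0 < n -> vr s nV = n ->
  (forall u v, u < n -> v < n -> c u v = c v u) ->
  (forall u v, u < n -> v < n -> ar s resA u v = c u v) ->
  (forall u, u < n -> ar s exA u 0 = d u) -> (forall u, u < n -> ar s skA u 0 = s0 u) ->
  \sum_(u < n) d u <= 2 * n * n ->
  vr (den route s) failV = 0 <-> feasible n c d s0.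
Proof.
move=> n0 sn cC Eres Eex Esk dn.
rewrite /route /pwhen !denE.
set p1 := PFor _ _ (PArr _ _ _ _); set s1 := den p1 s; set s2 := den sweeps s1.
have s1n : vr s1 nV = n by rewrite /s1 den_vr.
have h1 u : u < n -> ar s1 hA u 0 = 0.
  have [_ H] : (fun i s' => vr s' nV = n /\ forall u, u < i -> ar s' hA u 0 = 0) n s1; last exact: H.
  apply: (den_for (Inv := fun i s' => vr s' nV = n /\ forall u, u < i -> ar s' hA u 0 = 0)) => //.
  move=> i s' iN s'i [s'n H]; split=> //= v; rewrite /update andbT s'i.
  by case: eqP => // vi vi'; apply: H; lia.
have a1 k : k != hA -> ar s1 k = ar s k by move=> kh; rewrite /s1 den_ar //= inE.
have F1 : flow_inv n c d s0 s1.
  split=> //; rewrite ?(a1 resA) ?(a1 exA) ?(a1 skA) //.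
  - by move=> u v un vn; rewrite !Eres // (cC v u) // mul2n addnn.
  - move=> u un; rewrite Eex // Esk //; congr (_ + _).
    by apply: eq_bigr => v _; rewrite Eres.
  - by move=> u v un vn _; rewrite !h1.
  - by move=> u un _; exact: h1.
  - by move=> u un; rewrite h1.
  - by rewrite /excess a1 //; apply: leq_trans dn; apply: leq_sum => u _; rewrite Eex.
have P1 : potential n s1 < 6 * (n * (n * (n * n))).
  have ex1 := flow_excess F1.
  rewrite /potential (eq_bigr (fun=> n)) => [|u _]; last by rewrite h1 // subn0.
  rewrite [X in _ + X + _]big1 => [|u _]; last by rewrite h1 // muln0.
  rewrite sum_nat_const card_ord addn0; move: (excess n s1) ex1 => x; clear -n0.
  have : 0 < n * n by rewrite muln_gt0 n0.
  have -> : n * (n * (n * n)) = n * n * (n * n) by rewrite !mulnA.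
  rewrite -mulnA; move: (n * n) => m m0 xm; clear -m0 xm.
    nia.
have [F2 q2] := sweeps_spec n0 F1 P1; rewrite -/s2 in F2 q2.
rewrite -(flow_decide F2 q2); clearbody s2.
set s3 := den (PSet _ _) s2; set p4 := PFor _ _ _.
pose Inv i s' := [/\ vr s' nV = n, ar s' = ar s2 &
  vr s' failV = 0 <-> forall u, u < i -> ar s2 exA u 0 = 0].
suff [] : Inv n (den p4 s3) by [].
apply: (den_for (Inv := Inv)) => //.
- exact: flow_n F2.
- by split=> //; exact: flow_n F2.
move=> i s' iN s'i [s'n As H]; rewrite den_if /= As s'i.
case: eqP => exi; split=> //=.
  rewrite H; split=> H' u; last by move=> ui; apply: H'; lia.
  by rewrite ltnS leq_eqVlt => /orP[/eqP->|/H'].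
by split=> // H'; case: exi; apply: H'.
Qed.

(** * Preparing the data *)

Definition load (a b c : aexp) : prog :=
  PFor uV BVerts (seqs [:: PFor vV BVerts (PArr resA (AVar uV) (AVar vV) a);
    PArr exA (AVar uV) azero b; PArr skA (AVar uV) azero c]).

Definition keeps (s s' : state) : Prop :=
  [/\ vr s' nV = vr s nV, vr s' rV = vr s rV, ip s' = ip s &
      forall k, k \notin [:: resA; hA; exA; skA] -> ar s' k = ar s k].

Lemma load_spec n s a b c f g h : vr s nV = n ->
  (forall s' u v, keeps s s' -> vr s' uV = u -> vr s' vV = v -> u < n -> v < n -> ev s' a = f u v) ->
  (forall s' u, keeps s s' -> vr s' uV = u -> u < n -> ev s' b = g u) ->
  (forall s' u, keeps s s' -> vr s' uV = u -> u < n -> ev s' c = h u) ->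
  let s' := den (load a b c) s in
  [/\ forall u v, u < n -> v < n -> ar s' resA u v = f u v,
      forall u, u < n -> ar s' exA u 0 = g u &
      forall u, u < n -> ar s' skA u 0 = h u].
Proof.
move=> sn Ha Hb Hc s'.
have keep_set (s1 : state) k a1 b1 x : k \in [:: resA; hA; exA; skA] -> keeps s s1 -> keeps s (set_ar s1 k a1 b1 x).
  move=> kin [H1 H2 H3 H4]; split=> //= k' k'n; rewrite ifN ?H4 //.
  by apply: contra k'n => /eqP->.
have keep_var (s1 : state) k x : 1 < k -> keeps s s1 -> keeps s (set_vr s1 k x).
  by case: k => [|[|k]] // _ [H1 H2 H3 H4]; split.
pose Inv i s' := [/\ keeps s s', forall u v, u < i -> v < n -> ar s' resA u v = f u v,
      forall u, u < i -> ar s' exA u 0 = g u &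
      forall u, u < i -> ar s' skA u 0 = h u].
suff [] : Inv n s' by [].
apply: (den_for (Inv := Inv)) => //.
move=> i s1 iN s1i [K I1 I2 I3].
rewrite !denE; set p := PFor _ _ _; set s2 := den p s1.
have s2u : vr s2 uV = i by rewrite /s2 den_vr.
have [K2 R2 L2] : [/\ keeps s s2, forall v, v < n -> ar s2 resA i v = f i v &
   forall u v, u < i -> v < n -> ar s2 resA u v = f u v].
  pose Inv2 k s' := [/\ keeps s s', vr s' uV = i, forall v, v < k -> ar s' resA i v = f i v &
    forall u v, u < i -> v < n -> ar s' resA u v = f u v].
  suff [] : Inv2 n s2 by [].
  apply: (den_for (Inv := Inv2)) => //.
    by case: K => /= -> .
  move=> k s3 kN s3k [K3 s3u I4 I5]; split=> //.
  - by apply: (keep_var) => //; apply: keep_set.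
  - move=> v vk; rewrite /= /update s3u s3k eqxx /=.
    case: eqP => [->|vk']; first exact: Ha.
    by apply: I4; lia.
  - move=> u v ui vn; rewrite /= /update s3u s3k.
    by rewrite ifN ?I5 // negb_and; apply/orP; left; lia.
have x2 : ar s2 exA = ar s1 exA by rewrite /s2 den_ar.
have k2 : ar s2 skA = ar s1 skA by rewrite /s2 den_ar.
clearbody s2; split.
- by apply: keep_var => //=; do 2 apply: (keep_set) => //.
- move=> u v; rewrite ltnS leq_eqVlt /= => /orP[/eqP->|ui] vn; [exact: R2 | exact: L2].
- move=> u; rewrite ltnS /= /update s2u andbT x2 => ui.
  case: eqP => [->|ne]; first exact: Hb.
  by apply: I2; lia.
- move=> u; rewrite ltnS /= /update s2u andbT k2 => ui.
  case: eqP => [->|ne]; last by apply: I3; lia.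
  by apply: Hc => //; apply: keep_set.
Qed.

(* q = min(n, ceil(2 den / num)).  The cap n keeps the flow values polynomial; if
   it is active then 2 q > n, so that no nonempty set is routable. *)
Definition prep_q : prog :=
  seqs [:: PSet qV azero; PSet accV azero;
    PFor uV BVerts (pwhen (ASub (AAdd (AVar denV) (AVar denV)) (AVar accV))
      (seqs [:: PSet accV (AAdd (AVar accV) (AVar numV)); PSet qV (AAdd (AVar qV) aone)]))].

Lemma prep_q_spec s n num dn : vr s nV = n -> vr s numV = num -> vr s denV = dn ->
  let q := vr (den prep_q s) qV in
  [/\ q <= n, q = n \/ 2 * dn <= q * num & q = 0 \/ q.-1 * num < 2 * dn].
Proof.
move=> sn snum sden q.
pose Inv i s' := [/\ vr s' numV = num, vr s' denV = dn, vr s' accV = vr s' qV * num &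
  [/\ vr s' qV <= i, vr s' qV = i \/ 2 * dn <= vr s' qV * num &
     vr s' qV = 0 \/ (vr s' qV).-1 * num < 2 * dn]].
suff [_ _ _ []] : Inv n (den prep_q s) by [].
rewrite /prep_q /pwhen !denE; apply: (den_for (Inv := Inv)) => //.
  by split=> //=; split=> //; left.
move=> i s' iN s'i [Hn Hd Ha [Q1 Q2 Q3]].
rewrite den_if /=; rewrite Hn Hd Ha.
case: eqP => H /=; split=> //=; rewrite ?Hn ?Ha //.
- by split=> //; [lia | right; lia].
- by rewrite mulnDl mul1n.
- split; [lia | left; lia | right; rewrite addn1 /=; lia].
Qed.

Section Preparation.
Variables (n r : nat) (e : rel 'I_n) (T : 'I_r -> {set 'I_n}) (q : nat).
Hypothesis n_gt0 : 0 < n.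
Hypothesis eC : symmetric e.
Let U := \bigcup_j T j.

Definition encodes (s : state) : Prop :=
  [/\ vr s nV = n, vr s rV = r,
      forall u v : 'I_n, ip s u v = e u v &
      forall (j : 'I_r) (v : 'I_n), ip s (n + j) v = (v \in T j)].

Lemma encodes_keep s s' : vr s' nV = vr s nV -> vr s' rV = vr s rV -> ip s' = ip s ->
  encodes s -> encodes s'.
Proof. by move=> E1 E2 E3 [H1 H2 H3 H4]; split; rewrite ?E1 ?E2 ?E3. Qed.

Lemma row_edge s (u v : 'I_n) : encodes s -> mrow s u v = e u v.
Proof. by case=> H1 H2 H3 _; rewrite /mrow H1 H2 ltn_addr. Qed.

Lemma row_term s (j : 'I_r) (v : 'I_n) : encodes s -> mrow s (n + j) v = (v \in T j).
Proof. by case=> H1 H2 _ H4; rewrite /mrow H1 H2 ltn_add2l ltn_ord. Qed.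

Definition prep_term : prog :=
  PFor uV BVerts (PFor vV BSets (pwhen (AIn (AAdd (AVar nV) (AVar vV)) (AVar uV))
    (PArr termA (AVar uV) azero aone))).

Lemma prep_term_spec s : encodes s -> (forall u, ar s termA u 0 = 0) ->
  let s' := den prep_term s in forall u : 'I_n, ar s' termA u 0 = (u \in U).
Proof.
move=> es t0 s' u.
pose Inv i s' := [/\ encodes s', forall u : 'I_n, u < i -> ar s' termA u 0 = (u \in U) &
  forall u, i <= u -> ar s' termA u 0 = 0].
suff [_ H _] : Inv n s' by apply: H.
apply: (den_for (Inv := Inv)); first by case: es.
  by split=> // *; exact: t0.
move=> i s1 iN s1i [es1 I1 I2]; set p := PFor _ _ _.
pose Inv2 k s2 := [/\ encodes s2, vr s2 uV = i,
  ar s2 termA i 0 = [exists j : 'I_r, (j < k) && (Ordinal iN \in T j)] &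
  forall u, u != i -> ar s2 termA u 0 = ar s1 termA u 0].
have [H1 _ H3 H4] : Inv2 r (den p s1).
  apply: (den_for (Inv := Inv2)) => //; first by case: es1.
    by split=> //=; rewrite I2 //; case: existsP => // -[].
  move=> k s2 kr s2k [es2 s2u I3 I4].
  rewrite /pwhen den_if [ev _ _]/=; have [s2n _ _ _] := es2.
  rewrite s2n s2k s2u (row_term (Ordinal kr) (Ordinal iN) es2).
  have ex_step : [exists j : 'I_r, (j < k.+1) && (Ordinal iN \in T j)] =
      (Ordinal iN \in T (Ordinal kr)) || [exists j : 'I_r, (j < k) && (Ordinal iN \in T j)].
    apply/existsP/orP => [[j /andP[]]|[H|/existsP[j /andP[jk H]]]].
    - rewrite ltnS leq_eqVlt => /orP[/eqP jk|jk] H; [left|right].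
        by rewrite (_ : Ordinal kr = j) //; apply: val_inj.
      by apply/existsP; exists j; rewrite jk.
    - by exists (Ordinal kr); rewrite ltnSn.
    - by exists j; rewrite H ltnW.
  rewrite /Inv2 ex_step; case: (Ordinal iN \in _) => /=; split=> //=.
  - by rewrite /update s2u eqxx.
  - by move=> v vi; rewrite /update s2u (negbTE vi) I4.
split.
- exact: encodes_keep H1.
- move=> v /=; rewrite ltnS leq_eqVlt => /orP[/eqP vi|vi].
    rewrite vi H3; congr nat_of_bool; rewrite (_ : Ordinal iN = v); last exact: val_inj.
    by apply/existsP/bigcupP => -[j]; [case/andP=> _; exists j | exists j; rewrite ?ltn_ord].
  by rewrite H4 ?I1 // neq_ltn vi.
- by move=> v /= vi; rewrite H4 ?I2 //; [exact: ltnW | rewrite neq_ltn vi orbT].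
Qed.

Lemma sum_pick (A : {set 'I_n}) (x : 'I_n) k :
  \sum_(u in A) (if u == x :> nat then k else 0) = if x \in A then k else 0.
Proof.
rewrite -big_mkcondr /=; case: ifP => xA.
  rewrite (big_pred1 x) // => u; rewrite /=.
  by apply/andP/eqP => [[_ /eqP/val_inj]|->].
by rewrite big_pred0 // => u; apply/negP => /andP[uA /eqP/val_inj ux]; rewrite -ux uA in xA.
Qed.

(* An edge xy is a bridge iff two units of flow cannot be sent from x to y. *)
Definition test_bridge : prog :=
  seqs [:: load (AIn (AVar uV) (AVar vV)) azero azero; PArr exA (AVar xV) azero (ANum 2);
           PArr skA (AVar yV) azero (ANum 2); route].

Lemma test_bridge_spec s (x y : 'I_n) : encodes s -> e x y ->
  vr s xV = x -> vr s yV = y ->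
  vr (den test_bridge s) failV = 0 <-> ~~ bridge e x y.
Proof.
move=> es exy sx sy; have [sn sr _ _] := es.
rewrite /test_bridge !denE; set s1 := den (load _ _ _) s.
have [] := @load_spec n s (AIn (AVar uV) (AVar vV)) azero azero
  (fun u v => mrow s u v) (fun=> 0) (fun=> 0) sn => //.
  by move=> s' u v [H1 H2 H3 _] /= -> -> un vn; rewrite /mrow H1 H2 H3 sn ltn_addr.
rewrite -/s1 => R X K.
have s1x : vr s1 xV = x by rewrite /s1 den_vr.
have s1y : vr s1 yV = y by rewrite /s1 den_vr.
have s1n : vr s1 nV = n by rewrite /s1 den_vr.
clearbody s1.
set s2 := den (PArr _ _ _ _) (den _ s1).
have s2n : vr s2 nV = n by [].
have R2 u v : u < n -> v < n -> ar s2 resA u v = mrow s u v by exact: R.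
have X2 u : u < n -> ar s2 exA u 0 = if u == x then 2 else 0.
  by move=> un; rewrite /= /update s1x andbT X.
have K2 u : u < n -> ar s2 skA u 0 = if u == y then 2 else 0.
  by move=> un; rewrite /= /update s1y andbT K.
have roweC u v : u < n -> v < n -> mrow s u v = mrow s v u.
  by move=> un vn; rewrite (row_edge (Ordinal un) (Ordinal vn) es) (row_edge (Ordinal vn) (Ordinal un) es) eC.
have sum2 : \sum_(u < n) (if u == x :> nat then 2 else 0) <= 2 * n * n.
  have := sum_pick [set: 'I_n] x 2; rewrite inE (eq_bigl predT) => [->|u]; last by rewrite inE.
  by rewrite -mulnA leq_pmulr // muln_gt0 n_gt0.
clearbody s2; rewrite (route_spec n_gt0 s2n roweC R2 X2 K2 sum2).
have cutE (A : {set 'I_n}) : cut (fun u v : 'I_n => mrow s u v) A = cut (edge e) A.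
  by apply: eq_bigr => -[u v] _ /=; rewrite (row_edge _ _ es).
rewrite /bridge exy /=; split=> [feas|/existsPn br A].
  apply/existsPn => D; apply/negP => /and3P[xD yD D1].
  by have := feas D; rewrite cutE !sum_pick xD (negbTE yD); lia.
rewrite cutE !sum_pick; have := br A; case: (x \in A) => //=.
by case: (y \in A) => //=; lia.
Qed.

Definition set_cap : prog :=
  pwhen (AIn (AVar xV) (AVar yV))
    (seqs [:: test_bridge; PArr capA (AVar xV) (AVar yV) (AVar qV);
      pwhen (AVar failV) (PArr capA (AVar xV) (AVar yV) (AAdd (AVar qV) (AVar qV)))]).

Lemma set_cap_spec s (x y : 'I_n) : encodes s -> vr s qV = q ->
  vr s xV = x -> vr s yV = y -> ar s capA x y = 0 ->
  forall a b, ar (den set_cap s) capA a b =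
    if (a == x) && (b == y) then q * edge2 e x y else ar s capA a b.
Proof.
move=> es sq sx sy s0 a b.
rewrite /set_cap /pwhen den_if [ev _ _]/= sx sy (row_edge x y es).
have [exy|exy] := boolP (e x y); last first.
  rewrite /edge2 /bridge (negbTE exy) muln0 /=.
  by case: ifP => // /andP[/eqP-> /eqP->].
rewrite den_seqs; set s1 := den test_bridge s.
have br : vr s1 failV = 0 <-> ~~ bridge e x y := test_bridge_spec es exy sx sy.
have s1x : vr s1 xV = x by rewrite /s1 den_vr.
have s1y : vr s1 yV = y by rewrite /s1 den_vr.
have s1q : vr s1 qV = q by rewrite /s1 den_vr.
have s1c : ar s1 capA = ar s capA by rewrite /s1 den_ar.
clearbody s1; rewrite !denE /= s1x s1y s1q /edge2 exy.
have -> : q * (true + bridge e x y) = if vr s1 failV == 0 then q else q + q.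
  case: eqP => [/br/negbTE->|]; first by rewrite muln1.
  by case: bridge br => -[_ H]; [lia | case; apply: H].
by case: (vr s1 failV == 0) => /=; rewrite /update s1c //; case: (_ && _).
Qed.

Definition prep_cap : prog := PFor xV BVerts (PFor yV BVerts set_cap).

Lemma prep_cap_spec s : encodes s -> vr s qV = q -> (forall u v, ar s capA u v = 0) ->
  forall u v : 'I_n, ar (den prep_cap s) capA u v = q * edge2 e u v.
Proof.
move=> es sq c0.
have set_cap_keep s1 : encodes s1 -> vr s1 qV = q ->
    [/\ encodes (den set_cap s1), vr (den set_cap s1) qV = q & vr (den set_cap s1) xV = vr s1 xV].
  by move=> es1 s1q; split; [apply: encodes_keep es1 | | ]; rewrite ?den_vr ?den_ip.
move: set_cap_keep (@set_cap_spec); rewrite /prep_cap.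
generalize set_cap => p keep spec.
pose Inv i s' := [/\ encodes s', vr s' qV = q,
  forall u v : 'I_n, u < i -> ar s' capA u v = q * edge2 e u v &
  forall u v, i <= u -> ar s' capA u v = 0].
move=> u v; suff [_ _ H _] : Inv n (den (PFor xV BVerts (PFor yV BVerts p)) s) by apply: H.
clear u v.
apply: (den_for (Inv := Inv)); first by case: es.
  by split=> // *; exact: c0.
move=> i s1 iN s1i [es1 s1q I1 I2].
pose x := Ordinal iN.
pose Inv2 k s2 := [/\ encodes s2, vr s2 qV = q, vr s2 xV = x &
  [/\ forall v : 'I_n, v < k -> ar s2 capA x v = q * edge2 e x v,
  forall v, k <= v -> ar s2 capA x v = 0 &
  forall u v : nat, u != x -> ar s2 capA u v = ar s1 capA u v]].
have : Inv2 n (den (PFor yV BVerts p) s1).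
  apply: (den_for (Inv := Inv2)); first by case: es1.
    by split=> //; split=> // v' _; exact: I2.
  move=> k s2 kn s2k [es2 s2q s2x [I3 I4 I5]].
  have [es3 s3q s3x] := keep _ es2 s2q; have C := spec _ x (Ordinal kn) es2 s2q s2x s2k (I4 _ (leqnn k)).
  split=> //; first by rewrite /= s3x.
  split.
  - move=> w; rewrite ltnS leq_eqVlt /= C eqxx /= => /orP[/eqP wk|wk].
      have -> : w = Ordinal kn by exact: val_inj.
      by rewrite eqxx.
    by rewrite ifN ?I3 // neq_ltn wk.
  - by move=> w kw; rewrite /= C ifN ?I4 ?(ltnW kw) // negb_and (neq_ltn w) kw !orbT.
  - by move=> a b ai; rewrite /= C ifN ?I5 // negb_and ai.
move: (den (PFor yV BVerts p) s1) => s5 [H1 H2 _ [H3 _ H4]]; split=> //.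
- move=> a b /=; rewrite ltnS leq_eqVlt => /orP[/eqP ai|ai].
    have -> : a = x by exact: val_inj.
    exact: H3.
  by rewrite H4 ?I1 // neq_ltn ai.
- by move=> a b ai; rewrite /= H4 ?I2 //; [exact: ltnW | rewrite neq_ltn ai orbT].
Qed.
End Preparation.

(** * The greedy algorithm *)

Section Greedy.
Variables (n r : nat) (e : rel 'I_n) (T : 'I_r -> {set 'I_n}) (q : nat).
Hypotheses (n_gt0 : 0 < n) (q_gt0 : 0 < q) (q_le : q <= n).
Hypothesis eC : symmetric e.
Hypothesis conn : forall u v : 'I_n, connect e u v.
Hypothesis deg4 : forall v : 'I_n, degree e v <= 4.
Let U := \bigcup_j T j.
Hypothesis wl_or_capped :
  (forall A, 2 * wt U A <= #|U| -> 2 * wt U A <= q * cut (edge e) A) \/ n <= q.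

Definition test_add : prog :=
  seqs [:: load (AArr capA (AVar uV) (AVar vV)) (AArr demA (AVar uV) azero)
                (AArr termA (AVar uV) azero);
           PArr exA (AVar tV) azero (AAdd (AVar qV) (AVar qV)); route].

Definition scratch_vars := [:: failV; movedV; uV; vV; 20; 21; 22; 23; 24].
Definition scratch_arrs := [:: resA; hA; exA; skA].

Lemma test_add_vr s k : k \notin scratch_vars -> vr (den test_add s) k = vr s k.
Proof. exact: den_vr_sub. Qed.

Lemma test_add_ar s k : k \notin scratch_arrs -> ar (den test_add s) k = ar s k.
Proof. exact: den_ar_sub. Qed.

Lemma test_add_ip s : ip (den test_add s) = ip s.
Proof. exact: den_ip. Qed.

Definition selected (s : state) (j : 'I_r) : {set 'I_n} :=
  [set t : 'I_n | ar s selA j t != 0].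
Definition chosen (s : state) : {set 'I_n} := \bigcup_j selected s j.

Record greedy_inv (s : state) : Prop := GreedyInv {
  gi_enc : encodes e T s;
  gi_q : vr s qV = q;
  gi_cap : forall u v : 'I_n, ar s capA u v = q * edge2 e u v;
  gi_term : forall u : 'I_n, ar s termA u 0 = (u \in U);
  gi_dem : forall u : 'I_n, ar s demA u 0 = 2 * q * (u \in chosen s);
  gi_start : (vr s startV == 0) = (chosen s == set0);
  gi_sub : forall j, selected s j \subset T j;
  gi_disj : forall i j, i != j -> [disjoint selected s i & selected s j];
  gi_ok : #|chosen s| <= 1 \/ routable e U q (chosen s) }.

Lemma selected_eq s s' : ar s' selA = ar s selA -> selected s' = selected s.
Proof. by rewrite /selected => ->. Qed.

Lemma chosen_eq s s' : ar s' selA = ar s selA -> chosen s' = chosen s.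
Proof. by rewrite /chosen /selected => ->. Qed.

Lemma greedy_inv_eq s s' : vr s' nV = vr s nV -> vr s' rV = vr s rV ->
  vr s' qV = vr s qV -> vr s' startV = vr s startV -> ip s' = ip s ->
  ar s' capA = ar s capA -> ar s' termA = ar s termA -> ar s' demA = ar s demA ->
  ar s' selA = ar s selA -> greedy_inv s -> greedy_inv s'.
Proof.
move=> En Er Eq Es Ei Ec Et Ed El [G1 G2 G3 G4 G5 G6 G7 G8 G9].
have Eh := chosen_eq El; have Ej : selected s' = selected s by rewrite /selected El.
split; rewrite ?Eq ?Es ?Ec ?Et ?Ed ?Eh ?Ej //.
exact: encodes_keep G1.
Qed.

Lemma test_add_spec s (t : 'I_n) : greedy_inv s -> vr s tV = t ->
  vr (den test_add s) failV = 0 <-> routable e U q (t |: chosen s).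
Proof.
move=> [es sq scap sterm sdem _ _ _ _] st; have [sn sr _ _] := es.
rewrite /test_add !denE; set s1 := den (load _ _ _) s.
have L := @load_spec n s (AArr capA (AVar uV) (AVar vV)) (AArr demA (AVar uV) azero)
  (AArr termA (AVar uV) azero) (fun u v => ar s capA u v) (fun u => ar s demA u 0) (fun u => ar s termA u 0) sn.
have [R X K] : [/\ forall u v, u < n -> v < n -> ar s1 resA u v = ar s capA u v,
      forall u, u < n -> ar s1 exA u 0 = ar s demA u 0 &
      forall u, u < n -> ar s1 skA u 0 = ar s termA u 0].
  apply: L.
  - by move=> s' u v [_ _ _ H] Eu Ev _ _; rewrite [LHS]/= Eu Ev H.
  - by move=> s' u [_ _ _ H] Eu _; rewrite [LHS]/= Eu H.
  - by move=> s' u [_ _ _ H] Eu _; rewrite [LHS]/= Eu H.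
have s1t : vr s1 tV = t by rewrite /s1 den_vr.
have s1n : vr s1 nV = n by rewrite /s1 den_vr.
have s1q : vr s1 qV = q by rewrite /s1 den_vr.
clear L; clearbody s1.
set s2 := den (PArr _ _ _ _) s1.
have s2n : vr s2 nV = n by [].
pose I := t |: chosen s; pose d (u : nat) := if u == t :> nat then 2 * q else ar s demA u 0.
have dE (u : 'I_n) : d u = 2 * q * (u \in I).
  rewrite /d /I !inE sdem -[u == t :> nat]/(u == t).
  by case: (u == t); rewrite ?muln1.
have R2 u v : u < n -> v < n -> ar s2 resA u v = ar s capA u v by exact: R.
have X2 u : u < n -> ar s2 exA u 0 = d u.
  by move=> un; rewrite /d /= /update s1t s1q andbT X // mul2n -addnn.
have K2 u : u < n -> ar s2 skA u 0 = ar s termA u 0 by exact: K.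
have capC u v : u < n -> v < n -> ar s capA u v = ar s capA v u.
  by move=> un vn; rewrite (scap (Ordinal un) (Ordinal vn)) (scap (Ordinal vn) (Ordinal un)) edge2C.
have sumI (A : {set 'I_n}) : \sum_(u in A) d u = 2 * q * #|I :&: A|.
  rewrite (eq_bigr (fun u : 'I_n => 2 * q * (u \in I))) => [|u _]; last exact: dE.
  rewrite -big_distrr /= -sum1_card big_mkcond [in RHS]big_mkcond /=; congr (_ * _).
  by apply: eq_bigr => u _; rewrite in_setI; case: (u \in A); case: (u \in I).
have sumd : \sum_(u < n) d u <= 2 * n * n.
  have := sumI [set: 'I_n]; rewrite (eq_bigl predT) => [->|u]; last by rewrite inE.
  have : #|I :&: [set: 'I_n]| <= n by rewrite -[X in _ <= X]card_ord max_card.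
  by move=> In; rewrite leq_mul // leq_mul.
clearbody s2; rewrite (route_spec n_gt0 s2n capC R2 X2 K2 sumd).
have cutE (A : {set 'I_n}) : cut (fun u v : 'I_n => ar s capA u v) A = q * cut (edge2 e) A.
  by rewrite /cut /capacity big_distrr /=; apply: eq_bigr => -[u v] _ /=; rewrite scap.
have termE (A : {set 'I_n}) : \sum_(u in A) ar s termA u 0 = wt U A.
  rewrite /wt -sum1_card big_mkcond [in RHS]big_mkcond /=.
  by apply: eq_bigr => u _; rewrite sterm inE; case: (u \in A); case: (u \in U).
by split=> H A; have := H A; rewrite cutE termE sumI.
Qed.

Local Opaque test_add.

Definition select : prog :=
  seqs [:: PArr demA (AVar tV) azero (AAdd (AVar qV) (AVar qV));
           PArr selA (AVar jV) (AVar tV) aone; PSet foundV aone; PSet startV aone].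

Definition adds (s s' : state) (j : 'I_r) (t : 'I_n) : Prop :=
  [/\ chosen s' = t |: chosen s, t \notin selected s j,
      selected s' j = t |: selected s j &
      forall i, i != j -> selected s' i = selected s i].

Lemma select_spec s (j : 'I_r) (t : 'I_n) : greedy_inv s -> vr s jV = j -> vr s tV = t ->
  t \in T j -> t \notin chosen s ->
  chosen s = set0 \/ routable e U q (t |: chosen s) ->
  let s' := den select s in
  [/\ vr s' foundV != 0, greedy_inv s' & adds s s' j t].
Proof.
move=> [es sq scap sterm sdem _ ssub sdisj _] sj st tT tI ok s'.
have tsel i : t \notin selected s i by apply: contra tI => ti; apply/bigcupP; exists i.
have selj : selected s' j = t |: selected s j.
  apply/setP => x; rewrite !inE /s' /= /update sj st eqxx /= -[x == t :> nat]/(x == t).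
  by case: (x == t).
have seli i : i != j -> selected s' i = selected s i.
  move=> ij; apply/setP => x; rewrite !inE /s' /= /update sj st.
  by rewrite -[i == j :> nat]/(i == j) (negbTE ij).
have ch : chosen s' = t |: chosen s.
  rewrite /chosen (bigD1 j) //= selj [in RHS](bigD1 j) //= setUA; congr (_ :|: _).
  by apply: eq_bigr => i ij; rewrite seli.
suff G : greedy_inv s' by split.
split=> //.
- move=> u; rewrite ch /s' /= /update st sq andbT -[u == t :> nat]/(u == t) !inE.
  by case: eqP => [_|ut] /=; [rewrite muln1 mul2n addnn | rewrite sdem].
- by rewrite ch /=; apply/esym/set0Pn; exists t; rewrite !inE eqxx.
- move=> i; have [->|ij] := eqVneq i j; last by rewrite seli.
  by rewrite selj subUset sub1set tT ssub.
- have dj i : i != j -> [disjoint t |: selected s j & selected s i].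
    by move=> ij; rewrite -setI_eq0 setIUl setU_eq0 !setI_eq0 disjoints1 tsel sdisj // eq_sym.
  move=> i k ik; have [ij|ij] := eqVneq i j.
    by rewrite ij selj seli; [apply: dj | ]; rewrite -ij eq_sym.
  rewrite (seli _ ij); have [->|kj] := eqVneq k j; last by rewrite seli ?sdisj.
  by rewrite selj disjoint_sym dj.
- rewrite ch; case: ok => [->|ok]; last by right.
  by left; rewrite setU0 cards1.
Qed.

Lemma den_unless_set k j x s :
  vr (den (PIf (AVar k) PSkip (PSet j (ANum x))) s) j = if vr s k == 0 then x else vr s j.
Proof. by rewrite den_if /=; case: ifP => //=; rewrite eqxx. Qed.

(* The very first terminal is accepted without a test: a single terminal is
   1-well-linked, and it is all that is needed if r = 1 and T is small. *)
Definition try_add : prog :=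
  punless (AVar foundV) (pwhen (AIn (AAdd (AVar nV) (AVar jV)) (AVar tV))
    (punless (AArr demA (AVar tV) azero)
      (seqs [:: test_add; punless (AVar startV) (PSet failV azero);
                punless (AVar failV) select]))).

Definition rejected (I : {set 'I_n}) (t : 'I_n) : Prop :=
  I <> set0 /\ ~ routable e U q (t |: I).

Lemma try_add_spec s (j : 'I_r) (t : 'I_n) : greedy_inv s -> vr s jV = j -> vr s tV = t ->
  vr s foundV = 0 -> let s' := den try_add s in
  [/\ vr s' foundV = 0, greedy_inv s', ar s' selA = ar s selA &
      t \in T j -> t \notin chosen s -> rejected (chosen s) t] \/
  [/\ vr s' foundV != 0, greedy_inv s' & adds s s' j t].
Proof.
move=> Gs sj st sf; have [es sq scap sterm sdem sstart ssub sdisj sok] := Gs.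
have [sn _ _ _] := es.
move=> s'; rewrite {}/s' /try_add /pwhen /punless den_ifF //.
have Eterm : ev s (AIn (AAdd (AVar nV) (AVar jV)) (AVar tV)) = (t \in T j).
  by rewrite /= sn sj st (row_term j t es).
have Edem : ev s (AArr demA (AVar tV) azero) = 2 * q * (t \in chosen s) by rewrite /= st sdem.
have [tT|tT] := boolP (t \in T j); last first.
  by rewrite den_ifF ?Eterm ?(negbTE tT) //; left; split.
rewrite den_ifT ?Eterm ?tT //.
have [tI|tI] := boolP (t \in chosen s).
  by rewrite den_ifT ?Edem ?tI; [left; split | lia].
rewrite den_ifF ?Edem ?(negbTE tI) ?muln0 // den_seqs.
set s1 := den test_add s.
have T1 : vr s1 failV = 0 <-> routable e U q (t |: chosen s) := test_add_spec Gs st.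
have s1j : vr s1 jV = j by rewrite /s1 test_add_vr.
have s1t : vr s1 tV = t by rewrite /s1 test_add_vr.
have s1f : vr s1 foundV = 0 by rewrite /s1 test_add_vr.
have s1s : vr s1 startV = vr s startV by rewrite /s1 test_add_vr.
have s1l : ar s1 selA = ar s selA by rewrite /s1 test_add_ar.
have G1 : greedy_inv s1.
  by apply: greedy_inv_eq Gs => //; rewrite /s1 ?test_add_vr ?test_add_ar ?test_add_ip.
clearbody s1; rewrite den_seqs; set s2 := den (PIf (AVar startV) _ _) s1.
have s2j : vr s2 jV = j by rewrite /s2 den_vr.
have s2t : vr s2 tV = t by rewrite /s2 den_vr.
have s2f : vr s2 foundV = 0 by rewrite /s2 den_vr.
have s2l : ar s2 selA = ar s selA by rewrite /s2 den_ar.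
have G2 : greedy_inv s2.
  by apply: (greedy_inv_eq _ _ _ _ _ _ _ _ _ G1); rewrite /s2 ?den_vr ?den_ar ?den_ip.
have s2E : vr s2 failV = if vr s startV == 0 then 0 else vr s1 failV.
  by rewrite -s1s; apply: den_unless_set.
clearbody s2; have T2 : vr s2 failV = 0 <-> chosen s = set0 \/ routable e U q (t |: chosen s).
  rewrite s2E; case: ifP; rewrite sstart => /eqP; first by move=> ch; split=> //; left.
  by move=> ch; rewrite T1; split; [right | case].
rewrite den_seqs den_seqs0 den_if [ev _ _]/=.
have C2 : chosen s2 = chosen s := chosen_eq s2l.
have E2 : selected s2 = selected s := selected_eq s2l.
case: eqP => [f0|f0].
  have ok : chosen s2 = set0 \/ routable e U q (t |: chosen s2) by rewrite C2; apply/T2.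
  have tI2 : t \notin chosen s2 by rewrite C2.
  have [F G A] := select_spec G2 s2j s2t tT tI2 ok.
  by right; split=> //; move: A; rewrite /adds C2 E2.
left; rewrite den_seqs0; split=> // _ _; split=> [ch|rt]; apply: f0; apply/T2; by [left | right].
Qed.

Lemma try_add_found s : vr s foundV != 0 -> den try_add s = s.
Proof. by move=> sf; rewrite /try_add /punless den_ifT. Qed.

Definition add_to_group : prog := PSeq (PSet foundV azero) (PFor tV BVerts try_add).

Definition can_progress (I : {set 'I_n}) (j : 'I_r) : Prop :=
  (I = set0 /\ T j <> set0) \/ (32 * #|I| + 4) * q <= #|T j|.

Lemma routable0 : routable e U q set0.
Proof. by move=> A; rewrite set0I cards0 muln0. Qed.

Lemma progress_not_rejected s j : greedy_inv s -> can_progress (chosen s) j ->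
  exists t, [/\ t \in T j, t \notin chosen s & ~ rejected (chosen s) t].
Proof.
move=> Gs [[ch /eqP/set0Pn[t tT]]|big].
  by exists t; rewrite ch inE; split=> // -[].
have TU : T j \subset U by apply: bigcup_sup.
have TU' := subset_leq_card TU.
have big4 : 4 * q <= #|T j|.
  by apply: leq_trans big; rewrite leq_mul2r leq_addl orbT.
have wl : forall A, 2 * wt U A <= #|U| -> 2 * wt U A <= q * cut (edge e) A.
  case: wl_or_capped => // nq.
  have : #|T j| <= n by rewrite -[X in _ <= X]card_ord max_card.
  by clear -big4 nq q_gt0; lia.
have Ir : routable e U q (chosen s).
  case: (gi_ok Gs) => //; rewrite leq_eqVlt ltnS leqn0 => /orP[/cards1P[t ->]|/eqP/cards0_eq->].
    by apply: (routable1 eC conn) => //; apply: leq_trans TU'; clear -big4; lia.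
  exact: routable0.
have [t] := routable_extend eC conn deg4 q_gt0 wl Ir TU big.
by rewrite inE => /andP[tI tT] rt; exists t; split=> // -[_].
Qed.

Lemma add_to_group_spec s (j : 'I_r) : greedy_inv s -> vr s jV = j ->
  let s' := den add_to_group s in
  [/\ greedy_inv s', #|chosen s'| <= #|chosen s|.+1,
      forall i, selected s i \subset selected s' i &
      can_progress (chosen s) j -> #|selected s j| < #|selected s' j|].
Proof.
move=> Gs sj.
rewrite /add_to_group; have keep s1 : vr (den try_add s1) jV = vr s1 jV by rewrite den_vr.
move: keep (@try_add_spec) try_add_found; generalize try_add => p keep spec found.
pose Inv k s' := greedy_inv s' /\ vr s' jV = j /\
  ([/\ vr s' foundV = 0, ar s' selA = ar s selA &
      forall t : 'I_n, t < k -> t \in T j -> t \notin chosen s -> rejected (chosen s) t] \/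
  [/\ vr s' foundV != 0, #|chosen s'| <= #|chosen s|.+1,
      forall i, selected s i \subset selected s' i &
      #|selected s j| < #|selected s' j|]).
have : Inv n (den (PSeq (PSet foundV azero) (PFor tV BVerts p)) s).
  have G0 : greedy_inv (set_vr (set_vr s foundV 0) tV 0) by apply: greedy_inv_eq Gs.
  apply: (den_for (Inv := Inv)); first by case: (gi_enc Gs).
    by split=> //; split=> //; left.
  move=> k s1 kn s1k [G1 [s1j H]].
  have set_t s2 : greedy_inv s2 -> greedy_inv (set_vr s2 tV k.+1) by apply: greedy_inv_eq.
  case: H => [[s1f s1l rej]|[s1f H1 H2 H3]].
    case: (spec s1 j (Ordinal kn) G1 s1j s1k s1f) => [[f2 G2 l2 R2]|[f2 G2 [A1 A2 A3 A4]]].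
      split; [exact: set_t | split; first by rewrite /= keep].
      left; split=> //; first by rewrite /= l2.
      move=> t; rewrite ltnS leq_eqVlt => /orP[/eqP tk|]; last exact: rej.
      by rewrite (_ : t = Ordinal kn) -?(chosen_eq s1l) //; apply: val_inj.
    split; [exact: set_t | split; first by rewrite /= keep].
    rewrite (chosen_eq s1l) in A1; rewrite (selected_eq s1l) in A2 A3 A4.
    right; split=> //.
    - by rewrite -[chosen (set_vr _ _ _)]/(chosen (den p s1)) A1 cardsU1; case: (_ \notin _).
    - move=> i; rewrite -[selected (set_vr _ _ _)]/(selected (den p s1)).
      by have [->|ij] := eqVneq i j; [rewrite A3 subsetUr | rewrite A4].
    - by rewrite -[selected (set_vr _ _ _)]/(selected (den p s1)) A3 cardsU1 A2.
  rewrite found //; split; [exact: set_t | split=> //].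
  by right; split.
move: (den _ s) => s' [G' [_ H]]; split=> //; case: H => [[_ l' rej]|[_ H1 H2 H3]] //.
- by rewrite (chosen_eq l').
- by move=> i; rewrite (selected_eq l').
- case/(progress_not_rejected Gs) => t [tT tI []]; exact: rej.
Qed.

Definition add_round : prog := PFor jV BSets add_to_group.
Definition greedy : prog := PFor roundV BVerts add_round.

Definition large (k : nat) (j : 'I_r) : Prop := (32 * (r * k) + 4) * q <= #|T j|.

Lemma large_le k k' j : k <= k' -> large k' j -> large k j.
Proof.
move=> kk'; apply: leq_trans; rewrite leq_mul2r leq_add2r leq_mul2l leq_mul2l kk'.
by rewrite !orbT.
Qed.

(* After m complete rounds and i further groups. *)
Record progress_inv (m i : nat) (s : state) : Prop := ProgressInv {
  pi_inv : greedy_inv s;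
  pi_card : #|chosen s| <= r * m + i;
  pi_old : forall j k, k <= m -> large k j -> k <= #|selected s j|;
  pi_new : forall j : 'I_r, j < i -> large m.+1 j -> m < #|selected s j|;
  pi_empty : chosen s = set0 -> forall j : 'I_r, (0 < m) || (j < i) -> T j = set0 }.

Lemma progress_step m s (j : 'I_r) : progress_inv m j s -> vr s jV = j ->
  progress_inv m j.+1 (den add_to_group s).
Proof.
move=> [Gs H1 H2 H3 H4] sj; have := add_to_group_spec Gs sj.
move: (den _ s) => s' [G' C1 C2 C3].
have card_sel i : #|selected s i| <= #|selected s' i| by apply: subset_leq_card.
split=> //.
- by rewrite addnS; apply: leq_trans C1 _; rewrite ltnS.
- by move=> i k km ki; apply: leq_trans (card_sel i); apply: H2.
- move=> i; rewrite ltnS leq_eqVlt => /orP[/eqP/val_inj->|ij] big; last first.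
    by apply: leq_trans (card_sel i); apply: H3.
  have sm : m <= #|selected s j| by apply: H2 => //; apply: large_le big.
  apply: leq_ltn_trans sm _; apply: C3; right; apply: leq_trans big.
  rewrite leq_mul2r leq_add2r leq_mul2l; apply/orP; right; apply: leq_trans H1 _.
  by rewrite mulnS addnC leq_add2r ltnW.
- move=> ch'; have ch : chosen s = set0.
    apply/eqP; rewrite -subset0 -ch'; apply/bigcupsP => i _.
    by apply: subset_trans (C2 i) _; apply: bigcup_sup.
  move=> i; have [->|ij] := eqVneq i j; last first.
    have -> : (i < j.+1) = (i < j) by rewrite ltnS ltn_neqAle ij.
    exact: H4.
  move=> _; apply/eqP; apply: contraT => /eqP Tj.
  have : #|selected s j| < #|selected s' j| by apply: C3; left.
  rewrite ltnNge (_ : selected s' j = set0) ?cards0 //.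
  by apply/eqP; rewrite -subset0 -ch'; apply: bigcup_sup.
Qed.

Lemma progress_inv_var m i s k x : k \in [:: jV; roundV] ->
  progress_inv m i s -> progress_inv m i (set_vr s k x).
Proof.
move=> kin [G H1 H2 H3 H4]; split=> //; apply: greedy_inv_eq G => //=; move: kin; rewrite !inE => /orP[]/eqP-> //.
Qed.

Lemma greedy_spec s : greedy_inv s -> chosen s = set0 ->
  let s' := den greedy s in
  [/\ greedy_inv s', forall j k, k <= n -> large k j -> k <= #|selected s' j| &
      chosen s' = set0 -> forall j, T j = set0].
Proof.
move=> Gs ch s'.
suff [G _ H2 _ H4] : progress_inv n 0 s'.
  by split=> // ch' j; apply: H4; rewrite ?n_gt0.
rewrite {}/s' /greedy /add_round; move: progress_step; generalize add_to_group => p step.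
apply: (den_for (Inv := fun m s' => progress_inv m 0 s')).
- by case: (gi_enc Gs).
- apply: progress_inv_var => //; split=> //; first by rewrite ch cards0.
  by move=> j [].
move=> m s1 mn s1m P1; apply: progress_inv_var => //.
have : progress_inv m r (den (PFor jV BSets p) s1).
  apply: (den_for (Inv := fun i s' => progress_inv m i s')).
  - by case: (gi_enc (pi_inv P1)).
  - exact: progress_inv_var.
  - move=> i s2 ir s2i P2; apply: progress_inv_var => //.
    exact: (step m s2 (Ordinal ir)).
move: (den _ s1) => s2 [G H1 H2 H3 H4]; split=> //.
- by rewrite addn0 mulnS addnC.
- move=> j k; rewrite leq_eqVlt => /orP[/eqP->|]; [exact: H3 | exact: H2].
- by move=> ch2 j _; apply: H4; rewrite ?ltn_ord ?orbT.
Qed.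
End Greedy.

(** * The theorem *)

Definition write_out : prog :=
  PFor jV BSets (PFor tV BVerts (POut (AAdd (AVar nV) (AVar jV)) (AVar tV)
    (AArr selA (AVar jV) (AVar tV)))).

Lemma write_out_spec n r s : vr s nV = n -> vr s rV = r ->
  forall j t, j < r -> t < n -> ip (den write_out s) (n + j) t = ar s selA j t.
Proof.
move=> sn sr.
pose ok s' := [/\ vr s' nV = n, vr s' rV = r & ar s' = ar s].
pose Inv i s' := ok s' /\ forall j t, j < i -> t < n -> ip s' (n + j) t = ar s selA j t.
suff [_ H] : Inv r (den write_out s) by [].
apply: (den_for (Inv := Inv)) => //.
move=> i s1 ir s1i [ok1 I1].
pose Inv2 k s' := [/\ ok s', vr s' jV = i,
  forall j t, j < i -> t < n -> ip s' (n + j) t = ar s selA j t &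
  forall t, t < k -> ip s' (n + i) t = ar s selA i t].
have [ok3 _ H1 H2] : Inv2 n (den (PFor tV BVerts (POut (AAdd (AVar nV) (AVar jV)) (AVar tV)
    (AArr selA (AVar jV) (AVar tV)))) s1).
  apply: (den_for (Inv := Inv2)) => //; first by case: ok1.
  move=> k s2 kn s2k [[H1 H2 H3] s2j I2 I3].
  rewrite /= H1 H2 s2j s2k ltn_add2l ir; split=> //.
  - move=> j t ji tn /=; rewrite /update eqn_add2l ifN ?I2 //.
    by rewrite negb_and neq_ltn ji.
  - move=> t; rewrite ltnS leq_eqVlt /= /update eqxx /= => /orP[/eqP->|tk].
      by rewrite eqxx H3.
    by rewrite ifN ?I3 // neq_ltn tk.
move: (den _ s1) ok3 H1 H2 => s3 ok3 H1 H2; split=> // j t.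
by rewrite ltnS leq_eqVlt => /orP[/eqP-> tn|ji tn]; [exact: H2 | exact: H1].
Qed.

Definition main : prog := seqs [:: prep_q; prep_term; prep_cap; greedy; write_out].

Lemma wf_main : wf main.
Proof. by []. Qed.

Section Main.
Variables (n r : nat) (e : rel 'I_n) (T : 'I_r -> {set 'I_n}) (num dn : nat).

Definition start : state :=
  State (fun k => nth 0 [:: n; r; num; dn] k) (fun _ _ _ => 0)
    (fun i j => input e T num dn i.+1 j).

Lemma sim_start : sim (input e T num dn) start.
Proof.
split=> // i j; rewrite /mrow /=; case: ltnP => // ir.
rewrite /input /=; apply/eqP; rewrite eqb0 negb_or; apply/andP; split.
  apply/existsPn => u; apply/existsPn => v; rewrite eqSS.
  by apply/negP => /and3P[/eqP iu]; have := ltn_ord u; lia.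
apply/existsPn => l; apply/existsPn => v; rewrite eqSS.
by apply/negP => /and3P[/eqP iu]; have := ltn_ord l; lia.
Qed.

Lemma encodes_start : encodes e T start.
Proof.
split=> // [u v|j v]; rewrite /= /input /=; congr nat_of_bool.
  apply/orP/idP => [[]|euv].
  - case/existsP => u' /existsP[v' /and3P[/eqP[/val_inj->] /eqP/val_inj-> //]].
  - case/existsP => l /existsP[v' /and3P[/eqP[E]]]; have := ltn_ord u; lia.
  - by left; apply/existsP; exists u; apply/existsP; exists v; rewrite !eqxx.
apply/orP/idP => [[]|vT].
- by case/existsP => u /existsP[v' /and3P[/eqP[E]]]; have := ltn_ord u; lia.
- case/existsP => l /existsP[v' /and3P[/eqP[/addnI/val_inj->] /eqP/val_inj-> //]].
- by right; apply/existsP; exists j; apply/existsP; exists v; rewrite !eqxx.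
Qed.

Definition scale : nat := vr (den prep_q start) qV.
Let q := scale.
Let U := \bigcup_j T j.

Hypotheses (n_gt0 : 0 < n) (dn_gt0 : 0 < dn).
Lemma scale_spec : [/\ 0 < scale, scale <= n, scale = n \/ 2 * dn <= scale * num &
  scale.-1 * num < 2 * dn].
Proof.
have [H1 H2 H3] := @prep_q_spec start n num dn erefl erefl erefl; rewrite -/scale in H1 H2 H3.
have q0 : 0 < scale by case: H2; lia.
by split=> //; case: H3; lia.
Qed.

Hypothesis eC : symmetric e.
Hypothesis conn : forall u v : 'I_n, connect e u v.
Hypothesis deg4 : forall v : 'I_n, degree e v <= 4.
Hypothesis wl : 2 * dn <= scale * num ->
  forall A, 2 * wt U A <= #|U| -> 2 * wt U A <= scale * cut (edge e) A.

Lemma main_spec : let T' := fun j : 'I_r => [set t : 'I_n | mrow (den main start) (n + j) t != 0] in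
  let I := \bigcup_j T' j in
  [/\ forall j, T' j \subset T j, forall i j, i != j -> [disjoint T' i & T' j],
      forall A : {set 'I_n}, minn #|A :&: I| #|~: A :&: I| <= cut (edge e) A,
      forall j k, k <= n -> (32 * (r * k) + 4) * scale <= #|T j| -> k <= #|T' j| &
      I = set0 -> forall j, T j = set0].
Proof.
have [q0 qn qcap _] := scale_spec.
rewrite /main !denE.
set s1 := den prep_q start; set s2 := den prep_term s1; set s3 := den prep_cap s2.
have es1 : encodes e T s1 by apply: encodes_keep encodes_start; rewrite /s1 ?den_vr ?den_ip.
have q1 : vr s1 qV = scale by [].
have b1 : vr s1 startV = 0 by rewrite /s1 den_vr.
have a1 k : ar s1 k = fun _ _ => 0 by rewrite /s1 den_ar.
clearbody s1.
have es2 : encodes e T s2 by apply: encodes_keep es1; rewrite /s2 ?den_vr ?den_ip.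
have q2 : vr s2 qV = scale by rewrite /s2 den_vr.
have b2 : vr s2 startV = 0 by rewrite /s2 den_vr.
have a2 k : k != termA -> ar s2 k = fun _ _ => 0 by move=> kt; rewrite /s2 den_ar //= inE.
have t2 : forall u : 'I_n, ar s2 termA u 0 = (u \in U).
  by apply: prep_term_spec es1 _ => u; rewrite a1.
clearbody s2.
have es3 : encodes e T s3 by apply: encodes_keep es2; rewrite /s3 ?den_vr ?den_ip.
have q3 : vr s3 qV = scale by rewrite /s3 den_vr.
have b3 : vr s3 startV = 0 by rewrite /s3 den_vr.
have t3 : forall u : 'I_n, ar s3 termA u 0 = (u \in U) by move=> u; rewrite /s3 den_ar.
have d3 : ar s3 demA = fun _ _ => 0 by rewrite /s3 den_ar ?a2.
have l3 : ar s3 selA = fun _ _ => 0 by rewrite /s3 den_ar ?a2.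
have c3 : forall u v : 'I_n, ar s3 capA u v = scale * edge2 e u v.
  by apply: prep_cap_spec es2 q2 _ => // u v; rewrite a2.
clearbody s3.
have sel3 j : selected n s3 j = set0 by apply/setP => t; rewrite !inE l3.
have ch3 : chosen n r s3 = set0 by rewrite /chosen big1 // => j _; rewrite sel3.
have G3 : greedy_inv e T scale s3.
  split=> //.
  - by move=> u; rewrite d3 ch3 inE muln0.
  - by rewrite b3 ch3 !eqxx.
  - by move=> j; rewrite sel3 sub0set.
  - by move=> i j _; rewrite sel3 -setI_eq0 set0I.
  - by left; rewrite ch3 cards0.
have wl' : (forall A, 2 * wt U A <= #|U| -> 2 * wt U A <= scale * cut (edge e) A) \/ n <= scale.
  by case: qcap => [->|/wl]; [right | left].
have := greedy_spec n_gt0 q0 qn eC conn deg4 wl' G3 ch3.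
set s4 := den greedy s3 => -[G4 H2 H3].
have [n4 r4 _ _] := gi_enc G4.
clearbody s4; rewrite /main.
set s5 := den write_out s4.
have out j (t : 'I_n) : (mrow s5 (n + val (j : 'I_r)) t != 0) = (t \in selected n s4 j).
  rewrite /mrow /s5 !den_vr // n4 r4 ltn_add2l ltn_ord.
  by rewrite (write_out_spec n4 r4) ?ltn_ord // inE.
have outE (j : 'I_r) : [set t : 'I_n | mrow s5 (n + j) t != 0] = selected n s4 j.
  by apply/setP => t; rewrite inE out.
have IE : \bigcup_(j < r) [set t : 'I_n | mrow s5 (n + j) t != 0] = chosen n r s4.
  by apply: eq_bigr => j _; exact: outE.
rewrite /= IE; split=> //.
- by move=> j; rewrite outE; apply: gi_sub G4 j.
- by move=> i j ij; rewrite !outE; apply: gi_disj G4 i j ij.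
- have one_linked A : #|chosen n r s4| <= 1 ->
      minn #|A :&: chosen n r s4| #|~: A :&: chosen n r s4| <= cut (edge e) A.
    by have := wtC (chosen n r s4) A; rewrite /wt; lia.
  move=> A; case: (gi_ok G4) => [|rt]; first exact: one_linked.
  case: wl' => [wl'|nq]; first exact: (routable_well_linked eC q0 wl').
  apply: one_linked; have := routable_card rt; rewrite -/U.
  have : #|U| <= n by rewrite -[X in _ <= X]card_ord max_card.
  move: #|_| #|_| scale q0 nq => u i sc; clear; nia.
- by move=> j k kn lk; rewrite outE; apply: H2.
Qed.
End Main.

Local Open Scope ring_scope.

Lemma ln2_ge_half (R : realType) : 2^-1 <= ln 2 :> R.
Proof.
rewrite -[X in X <= _]expRK ler_ln ?posrE ?expR_gt0 //.
have := @expR_ge1Dx R (- 2^-1); rewrite expRN => h.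
rewrite -[X in X <= _]invrK -[X in _ <= X]invrK lef_pV2 ?posrE ?invr_gt0 ?expR_gt0 //.
by apply: le_trans h; lra.
Qed.

Lemma well_linked_cut (R : realType) n (e : rel 'I_n) (alpha : R) (U A : {set 'I_n}) (q num dn : nat) :
  (0 < dn)%N -> 0 < alpha -> num%:R / dn%:R <= alpha -> (2 * dn <= q * num)%N ->
  well_linked e alpha U -> (2 * wt U A <= #|U|)%N ->
  (2 * wt U A <= q * cut (edge e) A)%N.
Proof.
move=> dn0 a0 anum qnum /forallP/(_ A) wl wA.
have wmin : minn #|A :&: U| #|~: A :&: U| = wt U A.
  by have := wtC U A; rewrite /wt => ?; apply/minn_idPl; rewrite /wt in wA; lia.
have q2 : 2 <= q%:R * alpha.
  apply: le_trans (ler_wpM2l (ler0n R q) anum).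
  by rewrite mulrA ler_pdivlMr ?ltr0n // -!natrM ler_nat.
move: wl; rewrite wmin -cut_edges => wl.
rewrite -(ler_nat R) !natrM.
apply: le_trans (ler_wpM2l (ler0n R q) wl).
by rewrite mulrA ler_wpM2r // ler0n.
Qed.

Lemma scale_le (R : realType) (alpha : R) (q num dn : nat) : (0 < dn)%N ->
  0 < alpha -> alpha < 1 -> alpha <= 2 * (num%:R / dn%:R) ->
  (q.-1 * num < 2 * dn)%N -> q%:R * alpha <= 5.
Proof.
move=> dn0 a0 a1 anum qnum.
have q1 : q%:R <= q.-1%:R + 1 :> R by rewrite natr1 ler_nat; lia.
apply: le_trans (ler_wpM2r (ltW a0) q1) _.
have -> : 5 = 4 + 1 :> R by lra.
rewrite mulrDl mul1r lerD ?(ltW a1) //.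
apply: le_trans (ler_wpM2l (ler0n R _) anum) _.
rewrite !mulrA ler_pdivrMr ?ltr0n // -!natrM ler_nat; lia.
Qed.

Lemma large_enough (R : realType) (alpha : R) (r q K s : nat) : (0 < r)%N ->
  0 < alpha -> q%:R * alpha <= 5 -> (K < 2 * (52 * r * q * s))%N ->
  520^-1 * (alpha / r%:R ^+ 2) * K%:R <= s%:R.
Proof.
move=> r0 a0 qa Ks.
have r0' : 0 < r%:R :> R by rewrite ltr0n.
have KR : K%:R <= 104 * r%:R * q%:R * s%:R :> R.
  by rewrite -!natrM ler_nat; lia.
have aK : alpha * K%:R <= 520 * r%:R * s%:R.
  apply: le_trans (ler_wpM2l (ltW a0) KR) _.
  have -> : alpha * (104 * r%:R * q%:R * s%:R) = 104 * r%:R * s%:R * (q%:R * alpha) by ring.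
  have -> : 520 * r%:R * s%:R = 104 * r%:R * s%:R * 5 :> R by ring.
  by rewrite ler_wpM2l // !mulr_ge0 ?ler0n.
have -> : 520^-1 * (alpha / r%:R ^+ 2) * K%:R = (alpha * K%:R) / (520 * r%:R ^+ 2).
  by field; rewrite gt_eqF.
rewrite ler_pdivrMr ?mulr_gt0 ?exprn_gt0 ?ltr0n //.
apply: le_trans aK _.
have -> : s%:R * (520 * r%:R ^+ 2) = 520 * r%:R * s%:R * r%:R :> R by ring.
by rewrite ler_peMr ?mulr_ge0 ?ler0n // ler1n.
Qed.

Lemma few_terminals (R : realType) (alpha : R) (r q K : nat) : (1 < r)%N ->
  0 < alpha -> q%:R * alpha <= 5 -> 261 * (r%:R ^+ 2 * ln r%:R / alpha) <= K%:R ->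
  (52 * r * q <= K)%N.
Proof.
move=> r1 a0 qa big.
rewrite -(ler_nat R); apply: le_trans big.
have r0 : 0 < r%:R :> R by rewrite ltr0n; lia.
have lnr : 2^-1 <= ln r%:R :> R.
  by apply: le_trans (ln2_ge_half R) _; rewrite ler_ln ?posrE ?ltr0n ?ler_nat //; lia.
rewrite mulrA ler_pdivlMr // !natrM.
have -> : 52 * r%:R * q%:R * alpha = 52 * r%:R * (q%:R * alpha) by ring.
apply: (@le_trans _ _ (52 * r%:R * 5)); first by rewrite ler_wpM2l // mulr_ge0 ?ler0n.
apply: (@le_trans _ _ (261 * (r%:R ^+ 2 * 2^-1))); last first.
  by rewrite ler_wpM2l ?ler0n // ler_wpM2l ?exprn_ge0 ?ler0n.
have : 2 <= r%:R :> R by rewrite ler_nat.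
nra.
Qed.

Theorem theorem3 (R : realType) :
  exists c c' : R, 0 < c /\ 0 < c' /\
  forall d : nat,
  exists (P : cmd) (p : {poly nat}),
  forall (n r : nat) (e : rel 'I_n) (T : 'I_r -> {set 'I_n})
         (alpha : R) (num den k1 k2 : nat),
    simple_graph e ->
    connected_graph e ->
    (forall v : 'I_n, (degree e v <= 4)%N) ->
    (0 < r)%N ->
    0 < alpha -> alpha < 1 ->
    num%:R / den%:R <= alpha -> alpha <= 2 * (num%:R / den%:R) ->
    well_linked e alpha (\bigcup_j T j) ->
    (forall j : 'I_r, #|T j| = if val j == 0%N then k1 else k2) ->
    c * (r%:R ^+ 2 * ln r%:R / alpha) <= k1%:R ->
    c * (r%:R ^+ 2 * ln r%:R / alpha) <= k2%:R ->
    let M := input e T num den in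
    let m := p.[input_size n r num den] in
    (forall w : m.-tuple bool, halts_within P M w m) /\
    1 - (n%:R ^+ d)^-1
      <= coin_prob R (fun w : m.-tuple bool =>
           good_subsets e T alpha c' (output n r (contents (run P M w m)))).
Proof.
exists 261, 520^-1; split; first by rewrite ltr0n.
split; first by rewrite invr_gt0 ltr0n.
move=> d; exists (compile main), (tpoly main).
move=> n r e T alpha num dn k1 k2 [eC _] [Vn conn] deg4 r0 a0 a1 anum anum2 wl Tk ck1 ck2 M m.
rewrite card_ord in Vn.
have dn0 : (0 < dn)%N.
  rewrite lt0n; apply/eqP => dn0; move: anum2; rewrite dn0 invr0 !mulr0 => /le_lt_trans/(_ a0).
  by rewrite ltxx.
have [t [M' [tm simM runM]]] : exists t M', [/\ (t <= m)%N, sim M' (den main (start e T num dn)) &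
    forall k w, iter t step (Config (compile main :: k) M w) = Config k M' w].
  apply: compile_correct (wf_main) (sim_start e T num dn) _ _; rewrite /input_size /=; lia.
have runE w : run (compile main) M w m = Config [::] M' w.
  rewrite /run -(subnK tm) iterD runM.
  by elim: (m - t)%N => //= k ->.
split=> [w|]; first by rewrite /halts_within runE.
suff good : good_subsets e T alpha 520^-1 (output n r M').
  rewrite /coin_prob (_ : [set w | _] = setT); last first.
    by apply/setP => w; rewrite !inE runE.
  rewrite cardsT card_tuple card_bool natrX divff ?expf_neq0 ?pnatr_eq0 //.
  by rewrite lerBlDr lerDl invr_ge0 exprn_ge0 ?ler0n.
have wln : (2 * dn <= scale e T num dn * num)%N -> forall A,
    (2 * wt (\bigcup_j T j) A <= #|\bigcup_j T j|)%N ->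
    (2 * wt (\bigcup_j T j) A <= scale e T num dn * cut (edge e) A)%N.
  by move=> qnum A; apply: well_linked_cut dn0 a0 anum qnum wl.
have [H1 H2 H3 H4 H5] := main_spec Vn dn0 eC conn deg4 wln.
have [q0 qn _ qnum] := @scale_spec n r e T num dn Vn dn0.
have outE : output n r M' = fun j : 'I_r =>
    [set t0 : 'I_n | mrow (den main (start e T num dn)) (n + j) t0 != 0%N].
  by apply: boolp.funext => j; apply/setP => v; rewrite !inE; case: simM => _ ->.
have qa := scale_le dn0 a0 a1 anum2 qnum.
rewrite {}outE; move: H1 H2 H3 H4 H5; set T' := fun j => _.
move: (scale _ _ _ _) q0 qn qa => q q0 qn qa H1 H2 H3 H4 H5.
rewrite /good_subsets; apply/and4P; split.
- by apply/forallP.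
- by apply/forallP => i; apply/forallP => j; apply/implyP => /H2.
- apply/forallP => j.
  have [big|small] := leqP (52 * r * q) #|T j|.
    pose s := (#|T j| %/ (52 * r * q))%N.
    have rq0 : (0 < 52 * r * q)%N by rewrite !muln_gt0 r0.
    have s0 : (0 < s)%N by rewrite divn_gt0.
    have sT : (52 * r * q * s <= #|T j|)%N by rewrite mulnC leq_trunc_div.
    have Ts : (#|T j| < 2 * (52 * r * q * s))%N.
      have := ltn_ceil #|T j| rq0; rewrite -/s; clear -s0 rq0; nia.
    apply: le_trans (large_enough r0 a0 qa Ts) _; rewrite ler_nat; apply: H4.
      have : (#|T j| <= n)%N by rewrite -[X in (_ <= X)%N]card_ord max_card.
      by clear -sT rq0; nia.
    by clear -sT s0 r0; nia.
  have r1 : r = 1%N.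
    apply/eqP; rewrite eqn_leq r0 andbT leqNgt; apply/negP => r1.
    move: small; rewrite ltnNge; case/negP.
    by apply: (few_terminals r1 a0 qa); rewrite Tk; case: ifP.
  have [/eqP Tj|Tj] := boolP (#|T j| == 0%N).
    by rewrite Tj mulr0 ler0n.
  have small2 : (#|T j| < 2 * (52 * r * q * 1))%N by clear -small; lia.
  apply: le_trans (large_enough r0 a0 qa small2) _; rewrite ler_nat lt0n cards_eq0.
  apply: contra Tj => /eqP Tj; rewrite cards_eq0; apply/eqP; apply: H5.
  apply: big1 => i _; rewrite -Tj (_ : i = j) //; apply: ord_inj.
  by have := ltn_ord i; have := ltn_ord j; clear -r1; lia.
- apply/forallP => A; rewrite mul1r ler_nat -cut_edges; exact: H3.
Qed.
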